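(* Let $X$ be a nonempty shift of finite type (SFT) with entropy $\mathbf{h}(X)=\log\lambda$. For $n\in\mathbb{N}$ let $\mathcal{Z}_n\subset\Omega_n$ be the event that the random SFT $X_\omega$ has zero entropy (the empty SFT being counted as having zero entropy), and let $I_n$ be the random variable on $\Omega_n$ giving the number of irreducible components of $X_\omega$. Let $\{\gamma_i\}_{i}$ be an enumeration of the periodic orbits in $X$. Then for $0\le\alpha<1/\lambda$: (1) $\lim_{n\to\infty}\mathbb{P}_\alpha(\mathcal{Z}_n)=1$; (2) the sequence $(I_n)$ (under $\mathbb{P}_\alpha$) converges in distribution to the random variable $I_\infty$ such that $\mathbb{P}(I_\infty=0)=(\zeta_X(\alpha))^{-1}$ and, for $k\ge1$, $$\mathbb{P}(I_\infty=k)=(\zeta_X(\alpha))^{-1}\sum_{S:\,|S|=k}\ \prod_{s\in S}\frac{\alpha^{|\gamma_s|}}{1-\alpha^{|\gamma_s|}},$$ where the sum is over subsets $S$ of cardinality $k$ of the index set of the enumeration; (3) the random variable $I_\infty$ has exponentially decreasing tail and therefore finite moments of all orders.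
   Context: SFTs. Let $\mathcal{A}$ be a finite alphabet and $\sigma$ the left shift on $\mathcal{A}^{\mathbb{Z}}$ (product of discrete topologies). For a finite set $\mathcal{F}$ of finite words over $\mathcal{A}$, $X(\mathcal{F})$ is the set of $x\in\mathcal{A}^{\mathbb{Z}}$ in which no word of $\mathcal{F}$ appears; a shift of finite type (SFT) is a set $X$ of the form $X(\mathcal{F})$ with $\mathcal{F}$ finite. $B_n(X)$ is the set of words of length $n$ appearing in some $x\in X$. The entropy of $X$ is $\mathbf{h}(X)=\lim_n\frac1n\log|B_n(X)|$. An SFT $X$ is irreducible if for all nonempty open $U,V\subset X$ and every $N$ there is $n\ge N$ with $\sigma^n(U)\cap V\ne\varnothing$. An irreducible component of an SFT $X$ is a nonempty, maximal SFT contained in $X$ that is irreducible. $|\gamma|$ is the number of points of a periodic orbit $\gamma$. Zeta function. With $N_p=|\{x\in X:\sigma^p(x)=x\}|$, $\zeta_X(t)=\exp\big(\sum_{p=1}^\infty \frac{N_p}{p}t^p\big)$, which converges for $0\le t<1/\lambda$. Random SFTs. $\Omega_n$ is the power set of $B_n(X)$. For $\alpha\in[0,1]$, $\mathbb{P}_\alpha$ is the probability measure on $\Omega_n$ obtained by including each word of $B_n(X)$ in the random subset $\omega$ independently with probability $\alpha$. To $\omega\in\Omega_n$ one associates the SFT $X_\omega$ of all $x\in X$ such that every word of length $n$ appearing in $x$ belongs to $\omega$. Exponentially decreasing tail means: there are $K,\rho>0$ with $\mathbb{P}(I_\infty\ge k)\le Ke^{-\rho k}$ for all $k$. *)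

(* Defs.v *)
From HB Require Import structures.
From mathcomp Require Import all_boot all_order all_algebra finmap.
From mathcomp Require Import all_classical all_reals all_analysis.

Set Implicit Arguments.
Unset Strict Implicit.
Unset Printing Implicit Defensive.

Import Order.TTheory GRing.Theory Num.Theory.
Import numFieldNormedType.Exports.

Local Open Scope classical_set_scope.
Local Open Scope ring_scope.

Definition config (A : finType) : Type :=
  prod_topology (fun _ : int => discrete_topology A).

HB.instance Definition _ (A : finType) := Topological.on (config A).

Section Shifts.
Variable A : finType.
Implicit Types (X : set (config A)) (x : config A).

Definition shift x : config A := fun i => x (i + 1).

Definition appears (w : seq A) x : Prop :=
  exists i : int, mkseq (fun j => x (i + j%:Z)) (size w) = w.

Definition avoiding (F : seq (seq A)) : set (config A) :=
  [set x | forall w, w \in F -> ~ appears w x].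

Definition is_SFT X : Prop := exists F : seq (seq A), X = avoiding F.

Definition words X (n : nat) : {set n.-tuple A} :=
  [set w : n.-tuple A | `[< exists2 x, X x & appears w x >]]%SET.

(* For a nonempty shift the limit exists, by subadditivity. *)
Definition entropy (R : realType) X : R :=
  limn (fun n => ln #|words X n|%:R / n%:R).

Definition zero_entropy (R : realType) X : Prop := X = set0 \/ entropy R X = 0.

Definition rel_open X (U : set (config A)) : Prop :=
  exists2 O : set (config A), open O & U = X `&` O.

Definition irreducible_shift X : Prop :=
  forall U V, rel_open X U -> rel_open X V -> U !=set0 -> V !=set0 ->
  forall N : nat, exists2 n, (N <= n)%N & (iter n shift @` U) `&` V !=set0.

Definition irreducible_component X (C : set (config A)) : Prop :=
  [/\ is_SFT C, C `<=` X, irreducible_shift C, C !=set0 &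
      forall D, is_SFT D -> D `<=` X -> irreducible_shift D -> D !=set0 ->
        C `<=` D -> D = C].

(* [fset_set] is [fset0] on infinite sets; an SFT has finitely many
   irreducible components. *)
Definition nb_irreducible_components X : nat :=
  #|` fset_set (irreducible_component X)|.

(* The forward orbit of a periodic point is its whole orbit under the shift. *)
Definition periodic_orbits X : set (set (config A)) :=
  [set g | exists2 x, X x & (exists2 p, (0 < p)%N & iter p shift x = x) /\
                            g = range (fun k => iter k shift x)].

(* Only used on finite sets of points. *)
Definition nb_points (g : set (config A)) : nat := #|` fset_set g|.

Definition nb_fixed_points X (p : nat) : nat :=
  nb_points [set x | X x /\ iter p shift x = x].

(* Meaningful for 0 <= t < expR (- entropy X), where the series converges. *)
Definition zeta (R : realType) X (t : R) : R :=
  expR (limn (fun n =>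
    \sum_(1 <= p < n) (nb_fixed_points X p)%:R / p%:R * t ^+ p)).

End Shifts.

Section RandomSFT.
Variables (A : finType) (X : set (config A)) (n : nat).

Definition word_subsets : Type := {set {w : n.-tuple A | w \in words X n}}.

HB.instance Definition _ := Finite.on word_subsets.
HB.instance Definition _ := isPointed.Build word_subsets (finset.set0 : {set _}).
HB.instance Definition _ := @isMeasurable.Build default_measure_display
  word_subsets discrete_measurable discrete_measurable0
  discrete_measurableC discrete_measurableU.

Definition random_SFT (omega : word_subsets) : set (config A) :=
  [set x | X x /\
    forall w : n.-tuple A, appears w x -> w \in [set val u | u in omega]%SET].

Section Probability.
Variables (R : realType) (alpha : {i01 R}).

Definition include_pmf (omega : word_subsets) : R :=
  \prod_w bernoulli_pmf alpha%:num (w \in omega).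

Definition include_prob (E : set word_subsets) : \bar R :=
  (\sum_(omega \in E) (include_pmf omega)%:E)%E.

Lemma include_pmf_ge0 omega : 0 <= include_pmf omega.
Proof.
apply: prodr_ge0 => w _; apply: bernoulli_pmf_ge0.
by rewrite ge0 le1.
Qed.

Let include_prob0 : include_prob set0 = 0%E.
Proof. by rewrite /include_prob fsbig_set0. Qed.

Let include_prob_ge0 E : (0 <= include_prob E)%E.
Proof.
rewrite /include_prob fsbig_finite//= sumEFin lee_fin.
by apply: sumr_ge0 => omega _; exact: include_pmf_ge0.
Qed.

Let include_prob_sigma_additive : semi_sigma_additive include_prob.
Proof.
move=> F mF tF mUF; rewrite /include_prob.
apply: cvg_toP.
  apply: ereal_nondecreasing_is_cvgn => p m pm.
  apply: lee_sum_nneg_natr => // k _ _; exact: include_prob_ge0.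
transitivity (\sum_(0 <= i <oo) (\esum_(j in F i) (include_pmf j)%:E))%E.
  apply: eq_eseriesr => k _; rewrite esum_fset//= => b _.
  by rewrite lee_fin include_pmf_ge0.
rewrite -nneseries_sum_bigcup//=; last first.
  by move=> b; rewrite lee_fin include_pmf_ge0.
by rewrite esum_fset//= => b _; rewrite lee_fin include_pmf_ge0.
Qed.

HB.instance Definition _ := isMeasure.Build _ _ _ include_prob
  include_prob0 include_prob_ge0 include_prob_sigma_additive.

Let include_prob_setT : include_prob [set: _] = 1%E.
Proof.
rewrite /include_prob.
have -> : [set: word_subsets] = [set` enum (word_subsets : finType)].
  by apply/seteqP; split=> // omega _; rewrite /= mem_enum.
rewrite -fsbig_seq ?enum_uniq// sumEFin big_enum/=.
congr (_%:E); transitivity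
    (\prod_(w : {w | w \in words X n}) (alpha%:num + (1 - alpha%:num))).
  by rewrite bigA_distr.
by apply: big1 => w _; rewrite addrC subrK.
Qed.

HB.instance Definition _ :=
  @Measure_isProbability.Build _ _ R include_prob include_prob_setT.
End Probability.

Definition nb_components (R : realType) (omega : word_subsets) : R :=
  (nb_irreducible_components (random_SFT omega))%:R.

HB.instance Definition _ (R : realType) := isMeasurableFun.Build _ _
  word_subsets R (@nb_components R) (fun _ _ _ => I).

End RandomSFT.

(* The T n may be different probability spaces, so convergence in distribution
   is convergence of the distribution functions at every continuity point of
   the limiting one. *)
Definition cvg_in_distribution (R : realType)
    (d : nat -> measure_display) (T : forall n, measurableType (d n))
    (P : forall n, probability (T n) R) (Y : forall n, {RV P n >-> R})
    (d' : measure_display) (T' : measurableType d') (P' : probability T' R)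
    (Z : {RV P' >-> R}) : Prop :=
  forall x : R, {for x, continuous (cdf Z)} ->
    cdf (Y n) x @[n --> \oo] --> cdf Z x.

Definition exponential_tail (R : realType) (d : measure_display)
    (T : measurableType d) (P : probability T R) (Z : {RV P >-> R}) : Prop :=
  exists K rho : R, [/\ 0 < K, 0 < rho & forall k : nat,
    (P [set t | (k%:R <= Z t)%R] <= (K * expR (- rho * k%:R))%:E)%E].

Definition finite_moments (R : realType) (d : measure_display)
    (T : measurableType d) (P : probability T R) (Z : {RV P >-> R}) : Prop :=
  forall m : nat, ('E_P[fun t => (`|Z t| ^+ m)%R] < +oo)%E.

(* Main.v *)
(* Cut X into windows of length n: X_omega is then the set of bi-infinite walks
   staying in omega, and its periodic points are the closed walks. If no window
   lies on two different loops, the irreducible components of X_omega are exactly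
   its periodic orbits, and the entropy vanishes because a walk is determined by
   the times of its first visits to the windows.

   If some window lies on two loops, a pair of such loops with minimal total
   length yields a simple cycle of p windows and an ear with k further windows,
   where p + k >= n. All this is determined by p + max(0, k + 1 - n) letters and
   the return point, so the expected number of such configurations is at most a
   constant times the sum of p (alpha mu)^(p + k) over p + k >= n, for some
   mu > lambda with alpha mu < 1; it tends to 0.

   For large n the windows of the first N periodic orbits are pairwise disjoint,
   so these orbits survive independently with probabilities a = alpha^|gamma|,
   and the others contribute at most the tail of the convergent series of the a.
   Hence I_n converges in law to the cardinality of a random finite set S of orbit
   indices with weight proportional to the product of a / (1 - a) over S. The
   total weight is the product of 1 / (1 - a), which is zeta_X(alpha): expand
   -log (1 - a) and count fixed points orbit by orbit. Exponential moments of |S|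
   are finite because the product of 1 + e a / (1 - a) converges. *)
Require Import Defs.
From HB Require Import structures.
From mathcomp Require Import all_boot all_order all_algebra finmap.
From mathcomp Require Import all_classical all_reals all_analysis.
From mathcomp Require Import zify ring lra.

Set Implicit Arguments.
Unset Strict Implicit.
Unset Printing Implicit Defensive.

Import Order.TTheory GRing.Theory Num.Theory.
Import numFieldNormedType.Exports.

Local Open Scope classical_set_scope.
Local Open Scope ring_scope.

(** * Windows and loops *)

Section Windows.
Variable A : finType.
Implicit Types (x y z : config A) (a b i j : int) (p q k n : nat).

Definition has_period p x : Prop := forall i, x (i + p%:Z) = x i.

Definition window n x i : n.-tuple A := [tuple x (i + k%:Z) | k < n].

Definition translate a x : config A := fun i => x (i + a).

Lemma iter_shift k x i : iter k (@Defs.shift A) x i = x (i + k%:Z).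
Proof.
elim: k i => [|k IH] i /=; first by rewrite addr0.
by rewrite /Defs.shift IH; congr (x _); lia.
Qed.

Lemma iter_shift_translate k x : iter k (@Defs.shift A) x = translate k%:Z x.
Proof. by apply/funext => i; rewrite iter_shift. Qed.

Lemma has_periodP p x : iter p (@Defs.shift A) x = x <-> has_period p x.
Proof.
split=> [px i|px]; first by rewrite -iter_shift px.
by apply/funext => i; rewrite iter_shift.
Qed.

Lemma windowP n x y i j :
  window n x i = window n y j <-> forall k, (k < n)%N -> x (i + k%:Z) = y (j + k%:Z).
Proof.
split=> [xy k kn|xy]; last by apply: eq_from_tnth => k; rewrite !tnth_mktuple xy.
by have := congr1 (fun t => tnth t (Ordinal kn)) xy; rewrite !tnth_mktuple.
Qed.

Lemma window_translate n x a i : window n (translate a x) i = window n x (i + a).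
Proof.
apply/windowP => k _; rewrite /translate; congr (x _); lia.
Qed.

Lemma val_window n x i : window n x i = mkseq (fun k => x (i + k%:Z)) n :> seq A.
Proof.
apply: (@eq_from_nth _ (x 0)) => [|k]; first by rewrite size_tuple size_mkseq.
rewrite size_tuple => kn.
by rewrite nth_mkseq// -(tnth_nth _ _ (Ordinal kn)) tnth_mktuple.
Qed.

Lemma appears_window n (w : n.-tuple A) x : appears w x <-> exists i, window n x i = w.
Proof.
split=> -[i wi]; exists i; last by rewrite -wi size_tuple val_window.
by apply/val_inj; rewrite /= val_window -[RHS]wi size_tuple.
Qed.

Lemma wordsP X n (w : n.-tuple A) :
  w \in words X n <-> exists x i, X x /\ window n x i = w.
Proof.
rewrite inE; split=> [/asboolP[x Xx /appears_window[i wi]]|[x [i [Xx wi]]]].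
  by exists x, i.
by apply/asboolP; exists x => //; apply/appears_window; exists i.
Qed.

Lemma periodic_mul p x k : has_period p x -> has_period (p * k)%N x.
Proof.
move=> px; elim: k => [|k IH] i; first by rewrite muln0 addr0.
by rewrite mulnS addnC PoszD addrA px IH.
Qed.

Lemma periodicZ p x i m : has_period p x -> x (i + m * p%:Z) = x i.
Proof.
move=> px; case: m => k.
  by have := periodic_mul k px i; rewrite PoszM mulrC.
have := periodic_mul k.+1 px (i + Negz k * p%:Z) => <-.
by congr (x _); rewrite PoszM NegzE; ring.
Qed.

Lemma periodic_modz p x i a : (0 < p)%N -> has_period p x ->
  exists2 k, (k < p)%N & x i = x (a + k%:Z) /\ exists m, i = a + k%:Z + m * p%:Z.
Proof.
move=> p0 px; have p0' : (p%:Z != 0) by lia.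
have r0 := modz_ge0 (i - a) p0'; have rp := ltz_pmod (i - a) (_ : 0 < p%:Z).
have e := divz_eq (i - a) p%:Z.
exists `|((i - a) %% p%:Z)%Z|%N; first by have := rp; lia.
have -> : a + `|((i - a) %% p)%Z|%N%:Z = i - ((i - a) %/ p%:Z)%Z * p%:Z by lia.
split; last by exists ((i - a) %/ p%:Z)%Z; lia.
by rewrite -mulNr periodicZ.
Qed.

Lemma eq_periodic p x y a : (0 < p)%N -> has_period p x -> has_period p y ->
  (forall k, (k < p)%N -> x (a + k%:Z) = y (a + k%:Z)) -> x = y.
Proof.
move=> p0 px py xy; apply/funext => i.
have [k kp [-> [m im]]] := periodic_modz i a p0 px.
by rewrite im periodicZ // xy.
Qed.

Lemma periodic_translate p x a : has_period p x -> has_period p (translate a x).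
Proof. by move=> px i; rewrite /translate -(px (i + a)); congr (x _); lia. Qed.

Lemma translate_inj a : injective (translate a).
Proof.
move=> x y xy; apply/funext => i.
by have := congr1 (fun z => z (i - a)) xy; rewrite /translate subrK.
Qed.

Lemma translateD x a b : translate a (translate b x) = translate (a + b) x.
Proof. by apply/funext => i; rewrite /translate addrA. Qed.

(** * Subshifts given by allowed windows, and their closed walks *)

Section Subshift.
Variables (n : nat) (W : {set n.-tuple A}).

Definition window_shift : set (config A) := [set x | forall i, window n x i \in W].

Lemma window_shift_translate x a : window_shift x -> window_shift (translate a x).
Proof. by move=> Wx i; rewrite window_translate. Qed.

(** Repeat the [d] letters of [z] from [a] periodically. As the windows at [a] and [a + d] coincide,
    the repetition follows [z] for [n] further letters, so its windows are those of [z] at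
    [a, ..., a + d - 1]. *)
Lemma window_loop z a d : (0 < d)%N ->
    (forall k, (k < d)%N -> window n z (a + k%:Z) \in W) ->
    window n z a = window n z (a + d%:Z) ->
  exists y, [/\ window_shift y, has_period d y &
    forall k, (k < d + n)%N -> y (a + k%:Z) = z (a + k%:Z)].
Proof.
move=> d0 zW /windowP za.
have d0' : d%:Z != 0 by lia.
pose y : config A := fun i => z (a + ((i - a) %% d%:Z)%Z).
have yp : has_period d y.
  move=> i; rewrite /y; congr (z (a + _)).
  have -> : i + d%:Z - a = (i - a) + 1 * d%:Z by lia.
  by rewrite addrC modzMDl.
have yz k : (k < d + n)%N -> y (a + k%:Z) = z (a + k%:Z).
  elim/ltn_ind: k => k IH kdn; have [kd|dk] := ltnP k d.
    by rewrite /y addrAC subrr add0r modz_small//; lia.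
  have -> : a + k%:Z = (a + (k - d)%N%:Z) + d%:Z by lia.
  rewrite yp IH; [|lia|lia].
  rewrite za; last lia.
  by congr (z _); lia.
exists y; split=> // i.
have [k kd [_ [m im]]] := periodic_modz i a d0 yp.
suff -> : window n y i = window n z (a + k%:Z) by exact: zW.
apply/windowP => l ln; rewrite im addrAC periodicZ// -!addrA -PoszD.
by apply: yz; lia.
Qed.

(* The bound m on the total length serves to extract a minimal counterexample. *)
Definition loops_agree m : Prop := forall x y p q,
  window_shift x -> window_shift y -> (0 < p)%N -> (0 < q)%N -> (p + q < m)%N ->
  has_period p x -> has_period q y -> window n x 0 = window n y 0 -> x = y.

Definition unique_loops : Prop := forall m, loops_agree m.

Lemma loops_agree_at m x y p q i : loops_agree m ->
  window_shift x -> window_shift y -> (0 < p)%N -> (0 < q)%N -> (p + q < m)%N ->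
  has_period p x -> has_period q y -> window n x i = window n y i -> x = y.
Proof.
move=> Hm Wx Wy p0 q0 pq px qy xy; apply: (@translate_inj i).
apply: (Hm _ _ p q) => //; try exact: window_shift_translate;
  try exact: periodic_translate.
by rewrite !window_translate add0r.
Qed.

Lemma unique_loops_at x y p q i : unique_loops ->
  window_shift x -> window_shift y -> (0 < p)%N -> (0 < q)%N ->
  has_period p x -> has_period q y -> window n x i = window n y i -> x = y.
Proof. by move=> H Wx Wy p0 q0 px qy; apply: (loops_agree_at (H _)) (ltnSn _) px qy. Qed.

(* A closed walk through a repeated window splits there into two shorter ones. *)
Lemma loop_split m x p (i j : nat) : loops_agree m -> window_shift x -> has_period p x ->
    (p < m)%N -> (i < j < p)%N -> window n x i%:Z = window n x j%:Z ->
  has_period (j - i)%N x.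
Proof.
move=> Hm Wx px pm /andP[ij jp] xij.
have [y [Wy py yx]] : exists y, [/\ window_shift y, has_period (j - i) y &
    forall k, (k < (j - i) + n)%N -> y (i%:Z + k%:Z) = x (i%:Z + k%:Z)].
  apply: window_loop => //; first by rewrite subn_gt0.
  by rewrite xij; congr window; lia.
have [z [Wz pz zx]] : exists z, [/\ window_shift z, has_period (p - (j - i)) z &
    forall k, (k < (p - (j - i)) + n)%N -> z (j%:Z + k%:Z) = x (j%:Z + k%:Z)].
  apply: window_loop => //; first lia.
  rewrite -xij; apply/windowP => k _; rewrite -(px (i%:Z + k%:Z)).
  by congr (x _); lia.
(* Both pieces pass through the window at [j], and their lengths add up to [p < m]. The common walk
   then has period [p] and agrees with [x] over [p] consecutive letters. *)
have yz : y = z.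
  apply: (loops_agree_at (i := j%:Z) Hm Wy Wz _ _ _ py pz); try lia.
  apply/windowP => k kn; rewrite zx; last lia.
  have -> : j%:Z + k%:Z = i%:Z + (j - i + k)%N%:Z by lia.
  by rewrite yx//; lia.
suff <- : y = x by [].
have ppy : has_period p y.
  move=> l; have -> : l + p%:Z = (l + (p - (j - i))%N%:Z) + (j - i)%N%:Z by lia.
  by rewrite py yz pz.
apply: (@eq_periodic p y x i%:Z) => //; first lia.
move=> k kp; have [kj|jk] := ltnP k (j - i); first by rewrite yx//; lia.
have -> : i%:Z + k%:Z = j%:Z + (k - (j - i))%N%:Z by lia.
by rewrite yz zx//; lia.
Qed.

End Subshift.
End Windows.

(** * Irreducible components *)

Section Components.
Variable A : finType.
Implicit Types (x y z : config A) (C D : set (config A)) (i j : int) (p q k n N : nat).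

Definition orbit x : set (config A) := range (fun k => iter k (@Defs.shift A) x).

Lemma SFT_translate C x a : is_SFT C -> C x -> C (translate a x).
Proof.
move=> [F ->] Cx w wF [i wi]; apply: (Cx w wF); exists (i + a); rewrite -[RHS]wi.
by apply: eq_map => k; rewrite /translate; congr (x _); lia.
Qed.

Lemma orbit_self x : orbit x x.
Proof. by exists 0. Qed.

Lemma orbit_translate p x a : (0 < p)%N -> has_period p x -> orbit x (translate a x).
Proof.
move=> p0 px; have [k kp [_ [m am]]] := periodic_modz a 0 p0 px.
exists k => //; rewrite iter_shift_translate; apply/funext => i.
by rewrite /translate am add0r addrA periodicZ.
Qed.

Lemma orbitP x y : orbit x y -> exists k : nat, y = translate k%:Z x.
Proof. by move=> [k _ <-]; exists k; rewrite iter_shift_translate. Qed.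

Lemma open_cylinder n (w : n.-tuple A) i : open [set x : config A | window n x i = w].
Proof.
pose coord (k : 'I_n) := [set x : config A | x (i + k%:Z) = tnth w k].
have coord_open (k : 'I_n) : open (coord k).
  have /(@continuousP (config A) (discrete_topology A)) H :
      continuous (fun x : config A => x (i + k%:Z) : discrete_topology A).
    exact: (@proj_continuous int (fun=> discrete_topology A)).
  exact: (H [set tnth w k] (discrete_open _)).
suff : open [set x | forall k : 'I_n, k \in enum 'I_n -> coord k x].
  congr open; apply/seteqP; split=> x /=.
    by move=> xw; apply: eq_from_tnth => k; rewrite tnth_mktuple; apply: xw; rewrite mem_enum.
  by move=> xw k _; rewrite /coord /= -xw tnth_mktuple.
elim: (enum 'I_n) => [|k s IH].
  by rewrite (_ : mkset _ = setT); [exact: openT|apply/seteqP; split].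
rewrite (_ : mkset _ = coord k `&` [set x | forall k : 'I_n, k \in s -> coord k x]).
  exact: openI.
apply/seteqP; split=> x /=.
  by move=> xs; split=> [|l ls]; apply: xs; rewrite inE ?eqxx// ls orbT.
by move=> [xk xs] l; rewrite inE => /predU1P[->//|]; exact: xs.
Qed.

(** Irreducibility tested on two cylinders, a form that speaks of words only. *)
Lemma irreducible_windows C n x x' i j N : irreducible_shift C -> C x -> C x' ->
  exists m z, [/\ (N <= m)%N, C z, window n z i = window n x i &
    window n z (j + m%:Z) = window n x' j].
Proof.
move=> Cirr Cx Cx'.
pose U := C `&` [set y | window n y i = window n x i].
pose V := C `&` [set y | window n y j = window n x' j].
have [||||m Nm [_ [[z [Cz zi] <-] [_ zj]]]] := Cirr U V _ _ _ _ N.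
- by exists [set y | window n y i = window n x i] => //; exact: open_cylinder.
- by exists [set y | window n y j = window n x' j] => //; exact: open_cylinder.
- by exists x.
- by exists x'.
exists m, z; split=> //.
by rewrite -zj iter_shift_translate window_translate.
Qed.

Lemma irreducible_orbit p x : (0 < p)%N -> has_period p x -> irreducible_shift (orbit x).
Proof.
move=> p0 px U V [B _ ->] [B' _ ->] [u [xu Bu]] [v [xv B'v]] N.
have [a ua] := orbitP xu; have [b vb] := orbitP xv.
(* Moving by [b - a] modulo [p] takes [u] to [v]; the multiple [p * (a + N)] keeps the natural
   subtraction exact and the total at least [N]. *)
exists (b + p * (a + N) - a)%N; first nia.
exists v; split=> //; exists u => //.
rewrite iter_shift_translate ua vb translateD; apply/funext => i; rewrite /translate.
rewrite -(periodicZ (i + b%:Z) (a + N)%:Z px); congr (x _).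
have ap : (a <= b + p * (a + N))%N by nia.
by rewrite -PoszM; lia.
Qed.

(** Forbid the words of length [p + 1] that [x] does not show. The end letters of an allowed word
    coincide, so an allowed point is [p]-periodic, and one of its windows places it in the orbit. *)
Lemma SFT_orbit p x : (0 < p)%N -> has_period p x -> is_SFT (orbit x).
Proof.
move=> p0 px.
exists [seq tval w | w <- enum [set w : p.+1.-tuple A | `[< ~ appears w x >]]%SET].
apply/seteqP; split=> [y xy w /mapP[w' ]|y yx].
  rewrite mem_enum inE => /asboolP w'x -> /appears_window[i yi]; apply: w'x.
  have [a ya] := orbitP xy.
  by apply/appears_window; exists (i + a%:Z); rewrite -yi ya window_translate.
have yw i : exists j, window p.+1 x j = window p.+1 y i.
  apply/appears_window; apply: contrapT => ni.
  apply: (yx (window p.+1 y i)); last by apply/appears_window; exists i.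
  by apply: map_f; rewrite mem_enum inE; apply/asboolP.
have py : has_period p y.
  move=> i; have [j /windowP ij] := yw i.
  by rewrite -ij// px -(addr0 i) -(ij 0%N)// addr0.
have [j /windowP ij] := yw 0.
suff -> : y = translate j x by exact: orbit_translate px.
apply: (@eq_periodic _ p y _ 0) => //; first exact: periodic_translate.
by move=> k kp; rewrite -ij ?ltnS 1?ltnW// /translate; congr (x _); lia.
Qed.

Lemma periodic_orbitsP X g : periodic_orbits X g <->
  exists x p, [/\ X x, (0 < p)%N, has_period p x & g = orbit x].
Proof.
split=> [[x Xx [[p p0 /has_periodP px] ->]]|[x [p [Xx p0 /has_periodP px ->]]]].
  by exists x, p.
by exists x => //; split=> //; exists p.
Qed.

Section UniqueLoops.
Variables (n : nat) (W : {set n.-tuple A}).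
Hypothesis Wloops : unique_loops W.

(** Every stretch of a point of [C] recurs, and closing up the walk gives a loop; unique loops make
    the point itself that loop. Any other point of [C] is reached from [x], hence lies on the same
    loop. *)
Lemma irreducible_sub_orbit C x : C `<=` window_shift W -> is_SFT C ->
  irreducible_shift C -> C x -> exists p, [/\ (0 < p)%N, has_period p x & C = orbit x].
Proof.
move=> CW Csft Cirr.
(* Some [z] in [C] shows a stretch of [u] at [i] and again [m > M] steps later; the loop closed
   there copies [u] on [M + n] letters. *)
have loop u i M : C u -> exists y p, [/\ window_shift W y, (0 < p)%N, has_period p y &
    forall k, (k < M + n)%N -> y (i + k%:Z) = u (i + k%:Z)].
  move=> Cu; have [m [z [Mm Cz zi zim]]] := irreducible_windows (M + n) i i M.+1 Cirr Cu Cu.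
  move/windowP : zi => zi; move/windowP : zim => zim.
  have [|||y [Wy py yz]] := @window_loop _ _ W z i m.
  - by rewrite (leq_trans _ Mm).
  - by move=> k _; exact: CW.
  - by apply/windowP => k kn; rewrite zi ?zim//; lia.
  exists y, m; split=> //; first by rewrite (leq_trans _ Mm).
  by move=> k kMn; rewrite yz ?zi//; lia.
have period u : C u -> exists2 p, (0 < p)%N & has_period p u.
  move=> Cu; have [y0 [p [Wy0 p0 py0 y0u]]] := loop u 0 0%N Cu.
  exists p => //; suff -> : u = y0 by [].
  apply/funext => t.
  (* A loop copying [u] on a range that contains [t] and the window at 0 must be [y0]. *)
  have [y [q [Wy q0 qy yu]]] := loop u (- `|t|%N%:Z) (absz t).*2.+1 Cu.
  have -> : y0 = y.
    apply: (unique_loops_at (i := 0) Wloops Wy0 Wy p0 q0 py0 qy).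
    apply/windowP => k kn; rewrite y0u//.
    have -> : 0 + k%:Z = - `|t|%N%:Z + (absz t + k)%N%:Z by lia.
    by rewrite yu//; lia.
  have -> : t = - `|t|%N%:Z + (absz (t + (absz t)%:Z))%:Z by lia.
  by rewrite yu//; lia.
move=> Cx; have [p p0 px] := period _ Cx; exists p; split=> //.
apply/seteqP; split=> [y Cy|_ [k _ <-]]; last first.
  by rewrite iter_shift_translate; exact: SFT_translate.
(* The connecting point [z] shares a window with [x] and is periodic, so it equals [x]; hence [y]
   shares a window with a translate of [x]. *)
have [m [z [_ Cz z0 zm]]] := irreducible_windows n 0 0 0%N Cirr Cx Cy.
have [q q0 qz] := period _ Cz; have [r r0 ry] := period _ Cy.
have zx := unique_loops_at Wloops (CW _ Cz) (CW _ Cx) q0 p0 qz px z0.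
rewrite zx in zm.
suff -> : y = translate m%:Z x by exact: orbit_translate px.
apply: (unique_loops_at (i := 0) Wloops _ _ r0 p0 ry).
- exact: CW.
- exact/window_shift_translate/CW.
- exact: periodic_translate.
- by rewrite -zm window_translate.
Qed.

(** Maximality of an orbit holds because any irreducible SFT above it is again a single orbit. *)
Lemma irreducible_componentsE :
  irreducible_component (window_shift W) = periodic_orbits (window_shift W).
Proof.
apply/seteqP; split=> [C [Csft CW Cirr [x Cx] _]|C /periodic_orbitsP[x [p [Wx p0 px ->]]]].
  have [p [p0 px Cx']] := irreducible_sub_orbit CW Csft Cirr Cx.
  by apply/periodic_orbitsP; exists x, p; split=> //; exact: CW.
split.
- exact: SFT_orbit px.
- by move=> y /orbitP[k ->]; exact: window_shift_translate.
- exact: irreducible_orbit px.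
- by exists x; exact: orbit_self.
- move=> D Dsft DW Dirr _ xD.
  by have [q [_ _ ->]] := irreducible_sub_orbit DW Dsft Dirr (xD _ (orbit_self x)).
Qed.

End UniqueLoops.
End Components.

(** * Zero entropy *)

Section ZeroEntropy.
Variables (A : finType) (n : nat) (W : {set n.-tuple A}).
Hypotheses (n_gt0 : (0 < n)%N) (Wloops : unique_loops W).
Implicit Types (x y z : config A) (w : n.-tuple A).

(** The value is [m] when [w] is not met before time [m]. *)
Definition first_visit m x w : nat :=
  find (fun t : nat => window n x t == w) (iota 0 m).

Lemma first_visit_new m x (t : nat) : (t < m)%N ->
  (forall s : nat, (s < t)%N -> window n x s != window n x t) ->
  first_visit m x (window n x t) = t.
Proof.
move=> tm new; rewrite /first_visit; set a := (fun s : nat => _).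
have at' : has a (iota 0 m) by apply/hasP; exists t; rewrite ?mem_iota /a ?eqxx.
have := nth_find 0%N at'; rewrite nth_iota; last by rewrite -{2}(size_iota 0 m) -has_find.
rewrite add0n /a -/a => /eqP ft.
have [ft'|tf|//] := ltngtP (find a (iota 0 m)) t.
  by have := new _ ft'; rewrite ft eqxx.
by have := before_find 0%N tf; rewrite nth_iota// /a add0n eqxx.
Qed.

Lemma first_visit_window m x w (t : nat) : (t < m)%N -> first_visit m x w = t ->
  window n x t = w.
Proof.
move=> tm; rewrite /first_visit; set a := (fun s : nat => _) => ft.
have at' : has a (iota 0 m) by rewrite has_find ft size_iota.
by have := nth_find 0%N at'; rewrite ft nth_iota// add0n => /eqP.
Qed.

(** Induction on [t]. A window that is new at time [t] on one walk is read off from the first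
    visits. If both walks revisit, each is on a loop through its window at [t - 1]; that window is
    common, so the loops coincide and so do the windows at [t]. *)
Lemma first_visit_eq m x x' : window_shift W x -> window_shift W x' ->
  first_visit m x =1 first_visit m x' ->
  forall t : nat, (t < m)%N -> window n x t = window n x' t.
Proof.
move=> Wx Wx' xx'; elim/ltn_ind => t IH tm.
have revisit y : (forall s : nat, (s < t)%N -> window n y s != window n y t) \/
    exists2 s : nat, (s < t)%N & window n y s = window n y t.
  have [/existsP[s /eqP st]|] := boolP [exists s : 'I_t, window n y s == window n y t].
    by right; exists s.
  by rewrite negb_exists => /forallP new; left => s st; exact: (new (Ordinal st)).
have [new|[s st xs]] := revisit x.
  by have := first_visit_new tm new; rewrite xx' => /(first_visit_window tm).
have [new|[s' st' xs']] := revisit x'.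
  by have := first_visit_new tm new; rewrite -xx' => /(first_visit_window tm) ->.
have loop z (r : nat) : window_shift W z -> (r < t)%N -> window n z r = window n z t ->
    exists y p, [/\ window_shift W y, (0 < p)%N, has_period p y,
      window n y t.-1 = window n z t.-1 & window n y t = window n z t].
  move=> Wz rt zr; have [|||y [Wy py yz]] := @window_loop _ _ W z r (t - r).
  - by rewrite subn_gt0.
  - by move=> *; exact: Wz.
  - by rewrite zr; congr window; lia.
  exists y, (t - r)%N; split=> //; first by rewrite subn_gt0.
    apply/windowP => k kn; have -> : t.-1%:Z + k%:Z = r%:Z + (t.-1 - r + k)%N%:Z by lia.
    by apply: yz; lia.
  apply/windowP => k kn; have -> : t%:Z + k%:Z = r%:Z + (t - r + k)%N%:Z by lia.
  by apply: yz; lia.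
have [y [p [Wy p0 py y1 yt]]] := loop _ _ Wx st xs.
have [y' [p' [Wy' p0' py' y1' yt']]] := loop _ _ Wx' st' xs'.
rewrite -yt -yt'; congr (window n _ t).
apply: (unique_loops_at (i := t.-1%:Z) Wloops Wy Wy' p0 p0' py py').
by rewrite y1 y1'; apply: IH; lia.
Qed.

(** A word is coded by the first-visit times of its walk, a function from windows to [m + 1]
    values. *)
Lemma leq_card_words_unique_loops m :
  (#|words (window_shift W) m| <= m.+1 ^ #|{: n.-tuple A}|)%N.
Proof.
have [->|[w0 w0P]] := set_0Vmem (words (window_shift W) m); first by rewrite cards0.
have [x0 _] := (wordsP _ _).1 w0P.
have /choice[f fP] (w : m.-tuple A) : exists x, w \in words (window_shift W) m ->
    window_shift W x /\ window m x 0 = w.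
  have [|wW] := boolP (w \in words (window_shift W) m); last by exists x0.
  move=> /wordsP[x [i [Wx xw]]]; exists (translate i x) => _; split.
    exact: window_shift_translate.
  by rewrite window_translate add0r.
pose g (w : m.-tuple A) : {ffun n.-tuple A -> 'I_m.+1} :=
  [ffun w' => inord (first_visit m (f w) w')].
rewrite -[m.+1]card_ord -card_ffun.
apply: (@leq_card_in _ _ g) => w w' wW w'W gww'.
have [Wx xw] := fP _ wW; have [Wx' xw'] := fP _ w'W.
have ff' : first_visit m (f w) =1 first_visit m (f w').
  move=> v; have := congr1 (fun h : {ffun _ -> _} => val (h v)) gww'.
  have le u : (first_visit m (f u) v < m.+1)%N.
    by rewrite ltnS -{2}(size_iota 0 m) find_size.
  by rewrite !ffunE /= !inordK.
rewrite -xw -xw'; apply/windowP => k km.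
(* Letter [k] of the word is the first letter of the window at time [k]; this uses [n > 0]. *)
have /windowP/(_ 0%N n_gt0) := first_visit_eq Wx Wx' ff' km.
by rewrite !addr0 !add0r.
Qed.

End ZeroEntropy.

Lemma card_words_gt0 (A : finType) (X : set (config A)) m :
  X !=set0 -> (0 < #|words X m|)%N.
Proof.
move=> [x Xx]; apply/card_gt0P; exists (window m x 0).
by apply/wordsP; exists x, 0.
Qed.

Lemma ln_le_sqrt (R : realType) (x : R) : 0 < x -> ln x <= 2 * Num.sqrt x.
Proof.
move=> x0; have s0 : 0 < Num.sqrt x by rewrite sqrtr_gt0.
rewrite -[X in ln X](sqr_sqrtr (ltW x0)) expr2 lnM ?posrE// -mulr2n -[X in X <= _]mulr_natl.
by rewrite ler_pM2l// ltW// ln_sublinear.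
Qed.

Lemma entropy0_poly (R : realType) (A : finType) (X : set (config A)) K :
  X !=set0 -> (forall m, (#|words X m| <= m.+1 ^ K)%N) -> entropy R X = 0.
Proof.
move=> X0 XK; rewrite /entropy; apply: cvg_lim => //.
have wgt0 m : (1 : R) <= #|words X m|%:R by rewrite ler1n card_words_gt0.
(* With [s] the square root of [m + 1], [ln (m + 1) <= 2 * s]; the constant 4 comes from
   [2 * (m + 1) <= 4 * m] for [m > 0]. *)
apply: (@squeeze_cvgr _ _ _ _ (cst 0) (fun m => 4 * K%:R * Num.sqrt (harmonic m))).
- near=> m; apply/andP; split.
    by rewrite divr_ge0// ln_ge0.
  have m0 : (0 < m)%N by near: m; exact: nbhs_infty_gt.
  rewrite ler_pdivrMr ?ltr0n//.
  have -> : Num.sqrt (harmonic m : R) = (Num.sqrt (m.+1%:R))^-1 by rewrite /harmonic sqrtrV.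
  set s := Num.sqrt _.
  have s0 : 0 < s by rewrite sqrtr_gt0 ltr0n.
  have ss : s ^+ 2 = m.+1%:R by rewrite sqr_sqrtr.
  apply: (@le_trans _ _ (K%:R * (2 * s))).
    apply: (@le_trans _ _ (ln ((m.+1 ^ K)%N%:R))).
      by rewrite ler_ln ?posrE ?ltr0n ?expn_gt0 ?card_words_gt0// ler_nat.
    rewrite natrX lnXn ?ltr0n// -[X in X <= _]mulr_natl ler_wpM2l//.
    exact: ln_le_sqrt.
  have -> : 4 * K%:R / s * m%:R = K%:R * (4 * m%:R / s) by ring.
  apply: ler_wpM2l => //; rewrite ler_pdivlMr//.
  have -> : 2 * s * s = 2 * s ^+ 2 by ring.
  rewrite ss -!natrM ler_nat; lia.
- exact: cvg_cst.
- rewrite -[X in _ --> X](mulr0 (4 * K%:R)).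
  apply: cvgMr.
  have := @cvg_harmonic R.
  have := @sqrt_continuous R 0; rewrite /continuous_at sqrtr0 => sc.
  by move=> /(cvg_comp _ _)/(_ sc).
Unshelve. all: by end_near.
Qed.

(** * Windows lying on two loops *)

Section Theta.
Variables (A : finType) (d : A) (n : nat).
Implicit Types (x y z : config A) (p q k j : nat).

Definition nat_window (x : nat -> A) (i : nat) : n.-tuple A := [tuple x (i + t)%N | t < n].

Definition theta_cycle (u : seq A) : nat -> A := fun i => nth d u (i %% size u).

(** The first [n] letters are the window where the ear leaves the cycle; from position [k + 1] on,
    it reads the cycle from its point [j]. When [k < n] no letter comes from [v]. *)
Definition theta_ear k j (u v : seq A) : nat -> A := fun i =>
  if (i < n)%N then theta_cycle u i
  else if (i <= k)%N then nth d v (i - n)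
  else theta_cycle u (i - k.+1 + j).

(* A cycle of length p through the window w of u together with an ear that leaves
   it at w, visits k new windows and comes back at the j-th window of the cycle;
   v lists the letters of the ear that the cycle does not force. *)
Definition theta_windows p k j (u v : seq A) : {set n.-tuple A} :=
  ([set nat_window (theta_cycle u) i | i : 'I_p] :|:
   [set nat_window (theta_ear k j u v) i.+1 | i : 'I_k])%SET.

Lemma theta_cycleE x p i : has_period p x -> (0 < p)%N ->
  theta_cycle (window p x 0) i = x i%:Z.
Proof.
move=> px p0; rewrite /theta_cycle size_tuple val_window nth_mkseq ?ltn_pmod// add0r.
by rewrite [in RHS](divn_eq i p) PoszD PoszM addrC periodicZ.
Qed.

Lemma theta_earE x y p k j i : has_period p x -> (0 < p)%N ->
  window n x 0 = window n y 0 -> window n y k.+1 = window n x j ->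
  (i < k.+1 + n)%N ->
  theta_ear k j (window p x 0) (window (k.+1 - n) y n%:Z) i = y i%:Z.
Proof.
move=> px p0 /windowP xy /windowP yx ik; rewrite /theta_ear.
have [ilt|nle] := ltnP i n; first by rewrite theta_cycleE// -[i%:Z]add0r xy.
have [ilt|kle] := leqP i k.
  rewrite val_window nth_mkseq; last lia.
  by congr (y _); lia.
rewrite theta_cycleE//.
have -> : i%:Z = k.+1%:Z + (i - k.+1)%N%:Z by lia.
by rewrite yx; [congr (x _)|]; lia.
Qed.

Lemma nat_windowE (f : nat -> A) y i :
  (forall t, (t < n)%N -> f (i + t)%N = y (i + t)%N%:Z) -> nat_window f i = window n y i.
Proof.
by move=> fy; apply: eq_from_tnth => t; rewrite !tnth_mktuple fy// PoszD.
Qed.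

Variable W : {set n.-tuple A}.

(** At the least bound where [loops_agree] fails there is a pair of distinct loops such that all
    shorter pairs agree. A translation brings their first disagreement to position [n], right after
    a common window. *)
Lemma ex_shortest_loops : ~ unique_loops W -> exists m x y p q,
  [/\ loops_agree W m /\ (p + q)%N = m, window_shift W x /\ window_shift W y,
    (0 < p)%N /\ (0 < q)%N, has_period p x /\ has_period q y &
    window n x 0 = window n y 0 /\ x n != y n].
Proof.
move=> nW; have ex : exists m, ~~ `[< loops_agree W m >].
  apply: contrapT => nex; apply: nW => m; apply: contrapT => nm; apply: nex.
  by exists m; apply/asboolPn.
case: (ex_minnP ex) => m /asboolPn nm mmin.
have m0 : (0 < m)%N by rewrite lt0n; apply/eqP => m0; apply: nm; rewrite m0.
have mm : loops_agree W m.-1.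
  apply: contrapT => /asboolPn/mmin; lia.
have [x [y [p [q [[Wx Wy p0 q0] [pq px qy] xy nxy]]]]] : exists x y p q,
    [/\ [/\ window_shift W x, window_shift W y, (0 < p)%N & (0 < q)%N],
      [/\ (p + q < m)%N, has_period p x & has_period q y],
      window n x 0 = window n y 0 & x <> y].
  apply: contrapT => nex; apply: nm => x y p q Wx Wy p0 q0 pq px qy xy.
  by apply: contrapT => nxy; apply: nex; exists x, y, p, q.
have pqm : (p + q)%N = m.-1.
  apply/eqP; rewrite eqn_leq; apply/andP; split; first lia.
  rewrite leqNgt; apply/negP => lt; apply: nxy.
  exact: (mm x y p q).
(* Distinct loops with the common period [p * q] differ at some nonnegative position. *)
have : exists t : nat, x t%:Z != y t%:Z.
  apply: contrapT => nex; apply: nxy.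
  have pqx : has_period (p * q)%N x by exact: periodic_mul.
  have pqy : has_period (p * q)%N y by rewrite mulnC; exact: periodic_mul.
  apply: (@eq_periodic _ (p * q)%N _ _ 0) => //; first by rewrite muln_gt0 p0.
  move=> t _; rewrite add0r; apply/eqP; apply/negPn/negP => xyt; apply: nex; by exists t.
move=> /ex_minnP[t xyt tmin].
have nt : (n <= t)%N.
  rewrite leqNgt; apply/negP => tn; move/windowP : xy => /(_ t tn).
  by rewrite !add0r => /eqP; rewrite (negbTE xyt).
exists m.-1, (translate (t - n)%N x), (translate (t - n)%N y), p, q; split=> //.
- by split; exact: window_shift_translate.
- by split; exact: periodic_translate.
split.
  rewrite !window_translate !add0r; apply/windowP => k kn.
  apply/eqP/negPn/negP; rewrite -PoszD => /tmin; lia.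
rewrite /translate; have -> : n%:Z + (t - n)%N%:Z = t%:Z by lia.
by [].
Qed.

(** In a shortest pair of loops, [x] gives the cycle, and the ear is the part of [y] up to its first
    return to a window of that cycle. Minimality makes both loops simple, so the [p + k] windows are
    distinct. *)
Lemma ex_theta : (0 < n)%N -> ~ unique_loops W ->
  exists p k j (u : p.-tuple A) (v : (k.+1 - n).-tuple A),
  [/\ (0 < p)%N, (j < p)%N, (n <= p + k)%N,
    u \in words (window_shift W) p /\ v \in words (window_shift W) (k.+1 - n) &
    theta_windows p k j u v \subset W /\ #|theta_windows p k j u v| = (p + k)%N].
Proof.
move=> n0 /ex_shortest_loops[m [x [y [p [q [[mm pqm] [Wx Wy] [p0 q0] [px qy] [xy nxy]]]]]]].
have xNy : x <> y by move=> exy; rewrite exy eqxx in nxy.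
(* A repeated window would give [x] the smaller period [j - i], and that shorter pair would
   agree. *)
have no_split_x (i j : nat) : (i < j < p)%N -> window n x i != window n x j.
  move=> ijp; apply/eqP => xij; apply: xNy.
  have px' : has_period (j - i) x.
    by apply: (loop_split mm Wx px _ ijp xij); lia.
  by apply: (mm x y (j - i)%N q) => //; lia.
have no_split_y (i j : nat) : (i < j < q)%N -> window n y i != window n y j.
  move=> ijp; apply/eqP => yij; apply: xNy.
  have py' : has_period (j - i) y.
    by apply: (loop_split mm Wy qy _ ijp yij); lia.
  by apply: (mm x y p (j - i)%N) => //; lia.
pose back l := (0 < l)%N && [exists i : 'I_p, window n y l == window n x i].
have /ex_minnP[l /andP[l0 /existsP[j /eqP ylj]] lmin] : exists l, back l.
  exists q; rewrite /back q0; apply/existsP; exists (Ordinal p0).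
  rewrite /= xy; apply/eqP/windowP => t _.
  by rewrite addrC -[RHS]qy add0r addrC.
have lq : (l <= q)%N.
  apply: lmin; rewrite /back q0; apply/existsP; exists (Ordinal p0).
  rewrite /= xy; apply/eqP/windowP => t _.
  by rewrite addrC -[RHS]qy add0r addrC.
case: l l0 ylj lmin lq => // k _ ylj lmin lq.
have cyc (i : nat) : nat_window (theta_cycle (window p x 0)) i = window n x i.
  by apply: nat_windowE => t _; rewrite theta_cycleE.
have ear (i : nat) : (i <= k.+1)%N ->
    nat_window (theta_ear k j (window p x 0) (window (k.+1 - n) y n)) i = window n y i.
  by move=> ik; apply: nat_windowE => t tn; rewrite (theta_earE px)//; lia.
exists p, k, j, (window p x 0), (window (k.+1 - n) y n); split=> //.
(* If [p + k < n], the windows of [y] at 0 and at the return overlap in at least [p] letters. Then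
   the translates of [x] by [k + 1] and by [j] are equal, and [x] and [y] agree at [n]. *)
- rewrite leqNgt; apply/negP => pkn; move/eqP : nxy; apply.
  have xx : translate k.+1 x = translate j%:Z x.
    apply: (@eq_periodic _ p _ _ 0) => //; try exact: periodic_translate.
    move=> i ip; rewrite /translate add0r.
    move/windowP : ylj => /(_ i) ylj; rewrite ![i%:Z + _]addrC -ylj; last lia.
    move/windowP : xy => /(_ (k.+1 + i)%N); rewrite !add0r PoszD; apply; lia.
  have -> : n%:Z = (n - k.+1)%N%:Z + k.+1%:Z by lia.
  have := congr1 (@^~ (n - k.+1)%N%:Z) xx; rewrite /translate => ->.
  move/windowP : ylj => /(_ (n - k.+1)%N); rewrite addrC => ->; last lia.
  by rewrite addrC.
- by split; apply/wordsP; [exists x, 0|exists y, n%:Z].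
split.
  apply/fintype.subsetP => w /finset.setUP[] /imsetP[i _ ->]; first by rewrite cyc.
  by rewrite ear//; have := ltn_ord i; lia.
rewrite cardsU disjoint_setI0 ?cards0 ?subn0.
  rewrite !card_imset ?card_ord//.
    move=> i i'; rewrite !ear; [|by have := ltn_ord i'; lia|by have := ltn_ord i; lia].
    move=> yy; apply/val_inj => /=; have [ii|ii|//] := ltngtP i i'.
      have /eqP[] := no_split_y i.+1 i'.+1 ltac:(have := ltn_ord i'; lia).
      exact: yy.
    have /eqP[] := no_split_y i'.+1 i.+1 ltac:(have := ltn_ord i; lia).
    exact: esym.
  move=> i i'; rewrite !cyc => yy; apply/val_inj => /=; have [ii|ii|//] := ltngtP i i'.
    have /eqP[] := no_split_x i i' ltac:(have := ltn_ord i'; lia).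
    exact: yy.
  have /eqP[] := no_split_x i' i ltac:(have := ltn_ord i; lia).
  exact: esym.
rewrite -setI_eq0; apply/eqP/setP => w; rewrite !inE; apply/negP.
move=> /andP[/imsetP[i _ ->] /imsetP[i' _]]; rewrite cyc ear; last by have := ltn_ord i'; lia.
move=> xyi; have /lmin : back i'.+1 by apply/existsP; exists i; rewrite -xyi.
by rewrite ltnS leqNgt ltn_ord.
Qed.

End Theta.

(** * Growth of the number of words *)

Section Growth.
Variables (R : realType) (a : nat -> R).
Hypotheses (a_ge0 : forall n, 0 <= a n)
  (a_sub : forall m n, a (m + n)%N <= a m + a n).

Lemma subadditive_bound m : (0 < m)%N ->
  exists B, forall n, a n <= a m / m%:R * n%:R + B.
Proof.
move=> m0; have mR : 0 < m%:R :> R by rewrite ltr0n.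
have am q : a (q * m)%N <= q%:R * a m + a 0%N.
  elim: q => [|q IH]; first by rewrite mul0n mul0r add0r.
  rewrite mulSn (le_trans (a_sub _ _))// mulrSr mulrDl mul1r.
  by move: IH; lra.
(* The sum covers every possible remainder of [n] modulo [m]; [a 0] pays for the empty multiple. *)
exists (\sum_(r < m) a r + a 0%N) => n.
rewrite {1}(divn_eq n m) (le_trans (a_sub _ _))//.
have ar : a (n %% m)%N <= \sum_(r < m) a r.
  rewrite (bigD1 (Ordinal (ltn_pmod n m0)))//= lerDl.
  by apply: sumr_ge0.
have qn : (n %/ m)%:R * a m <= a m / m%:R * n%:R.
  rewrite mulrAC -mulrA mulrC ler_wpM2l// ler_pdivlMr// -natrM ler_nat.
  exact: leq_divM.
have := am (n %/ m)%N; lra.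
Qed.

(** Fekete's lemma: the infimum is nearly attained at some index, and the division bound carries
    that slope to all large [n]. *)
Lemma fekete_subadditive :
  a n / n%:R @[n --> \oo] --> inf (range (fun m => a m.+1 / m.+1%:R)).
Proof.
set S := range _; set L := inf S.
have Sne : S !=set0 by exists (a 1%N / 1%:R); exists 0%N.
have Slb : lbound S 0 by move=> _ [m _ <-]; rewrite divr_ge0.
have hS : has_inf S by split=> //; exists 0.
apply/cvgrPdist_le => e e0.
have [_ [m _ <-] mL] := inf_adherent (eps := e / 2) (divr_gt0 e0 (ltr0Sn _ 1)) hS.
have [B aB] := subadditive_bound (ltn0Sn m).
near=> n.
have n0 : (0 < n)%N by near: n; exact: nbhs_infty_gt.
have nR : 0 < n%:R :> R by rewrite ltr0n.
have Ln : L <= a n / n%:R by apply: ge_inf; [exists 0|exists n.-1; rewrite ?prednK].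
rewrite distrC ger0_norm ?subr_ge0// lerBlDr.
apply: (@le_trans _ _ (a m.+1 / m.+1%:R + B / n%:R)).
  rewrite ler_pdivrMr// mulrDl divfK ?gt_eqF//; exact: aB.
have Bn : B / n%:R <= e / 2.
  rewrite ler_pdivrMr// -ler_pdivrMl ?divr_gt0//.
  by near: n; exact: nbhs_infty_ger.
by apply: (le_trans (lerD (ltW mL) Bn)); rewrite -/L; lra.
Unshelve. all: by end_near.
Qed.

Lemma growth_lim l : limn (fun n => a n / n%:R) < l ->
  exists B, forall n, a n <= l * n%:R + B.
Proof.
rewrite (cvg_lim _ fekete_subadditive)// => /inf_lt[|_ [m _ <-] ml].
  by exists (a 1%N / 1%:R); exists 0%N.
have [B aB] := subadditive_bound (ltn0Sn m); exists B => n.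
by rewrite (le_trans (aB n))// lerD2r ler_wpM2r// ltW.
Qed.

Lemma lim_subadditive_ge0 : 0 <= limn (fun n => a n / n%:R).
Proof.
apply: limr_ge; first by apply/cvg_ex; eexists; exact: fekete_subadditive.
by apply: nearW => n; rewrite divr_ge0.
Qed.

End Growth.

(** * Word counts of a shift *)

Section Words.
Variable A : finType.
Implicit Types X Y : set (config A).

Lemma words_subset X Y m : X `<=` Y -> words X m \subset words Y m.
Proof.
move=> XY; apply/fintype.subsetP => w /wordsP[x [i [Xx xw]]].
by apply/wordsP; exists x, i; split=> //; exact: XY.
Qed.

Lemma card_wordsD X m k : (#|words X (m + k)| <= #|words X m| * #|words X k|)%N.
Proof.
rewrite -cardsX.
pose f (w : (m + k).-tuple A) : m.-tuple A * k.-tuple A :=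
  ([tuple tnth w (lshift k i) | i < m], [tuple tnth w (rshift m i) | i < k]).
have f_inj : injective f.
  move=> w w' ww'; apply: eq_from_tnth => i; case: (split_ordP i) => l ->.
    by have := congr1 (fun t => tnth t.1 l) ww'; rewrite !tnth_mktuple.
  by have := congr1 (fun t => tnth t.2 l) ww'; rewrite !tnth_mktuple.
rewrite -(card_imset _ f_inj); apply: subset_leq_card.
apply/fintype.subsetP => _ /imsetP[w /wordsP[x [i [Xx <-]]] ->].
rewrite finset.in_setX; apply/andP; split; apply/wordsP; exists x.
  by exists i; split=> //; apply: eq_from_tnth => l; rewrite !tnth_mktuple.
exists (i + m%:Z); split=> //; apply: eq_from_tnth => l.
by rewrite !tnth_mktuple /= PoszD addrA.
Qed.

(** [ln #|words X m|] is subadditive, so a rate slightly above [lambda] bounds all word counts up to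
    a constant factor. *)
Lemma words_growth (R : realType) X (lambda alpha : R) : X !=set0 -> 0 < lambda ->
    entropy R X = ln lambda -> 0 <= alpha <= 1 -> alpha < lambda^-1 ->
  exists C mu : R, [/\ 0 < C, 1 <= mu, alpha * mu < 1 &
    forall m, #|words X m|%:R <= C * mu ^+ m].
Proof.
move=> X0 l0 hX /andP[al0 al1] al.
pose a m : R := ln #|words X m|%:R.
have w1 m : (1 : R) <= #|words X m|%:R by rewrite ler1n card_words_gt0.
have w0 m : (0 : R) < #|words X m|%:R by rewrite ltr0n card_words_gt0.
have a0 m : 0 <= a m by exact: ln_ge0.
have aD m k : a (m + k)%N <= a m + a k.
  rewrite /a -lnM ?posrE// ler_ln ?posrE ?mulr_gt0//.
  by rewrite -natrM ler_nat card_wordsD.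
have l1 : 1 <= lambda.
  rewrite leNgt; apply/negP => l1; have /ln_lt0 : 0 < lambda < 1 by rewrite l0.
  by rewrite -hX ltNge => /negP; apply; exact: lim_subadditive_ge0.
have all : alpha * lambda < 1 by rewrite -ltr_pdivlMr// div1r.
(* As [alpha <= 1], adding half of the gap [1 - alpha * lambda] keeps [alpha * mu] below 1. *)
pose mu := lambda + (1 - alpha * lambda) / 2.
have lmu : lambda < mu by rewrite /mu ltrDl divr_gt0// subr_gt0.
have mu0 : 0 < mu by exact: lt_trans lmu.
have [|B aB] := @growth_lim _ _ a0 aD (ln mu); first by rewrite [X in X < _]hX ltr_ln.
exists (expR B), mu; split; first exact: expR_gt0.
- by rewrite (le_trans l1)// ltW.
- rewrite /mu mulrDr.
  have : alpha * ((1 - alpha * lambda) / 2) <= (1 - alpha * lambda) / 2.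
    by rewrite ler_piMl// divr_ge0// subr_ge0 ltW.
  by move: all; lra.
move=> m; have Cmu : 0 < expR B * mu ^+ m by rewrite mulr_gt0 ?expR_gt0 ?exprn_gt0.
rewrite -ler_ln ?posrE// lnM ?posrE ?expR_gt0 ?exprn_gt0// expRK lnXn// addrC.
by rewrite -[ln mu *+ m]mulr_natr; exact: aB.
Qed.

(** Once [n] is at least the length of every forbidden word, a point whose windows are all words of
    [X] belongs to [X]. *)
Lemma random_SFT_windows X : is_SFT X -> exists n0 : nat, forall n, (n0 <= n)%N ->
  forall omega : word_subsets X n,
  random_SFT omega = window_shift [set val u | u in omega]%SET.
Proof.
move=> [F XF]; exists (\max_(w <- F) size w)%N => n n0 omega.
apply/seteqP; split=> [x [Xx xw] i|x xw].
  by apply: xw; apply/appears_window; exists i.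
split; last by move=> w /appears_window[i <-]; exact: xw.
rewrite XF => w wF [i wi].
have wn : (size w <= n)%N by apply: leq_trans n0; exact: leq_bigmax_seq.
have /imsetP[u _ xu] := xw i.
have /wordsP[y [j [Xy yx]]] := valP u; rewrite -xu in yx.
move: Xy; rewrite XF => /(_ w wF); apply; exists j; rewrite -[RHS]wi.
apply/eq_in_map => k; rewrite mem_iota add0n => /andP[_ kw].
by move/windowP : yx => ->//; exact: leq_trans wn.
Qed.

End Words.

(** * Random subsets *)

Section RandomSubset.
Variables (R : realType) (T : finType) (a : R).
Hypotheses (a_ge0 : 0 <= a) (a_le1 : a <= 1).
Implicit Types (omega D : {set T}) (E : pred {set T}).

Definition subset_pmf omega : R := \prod_w (if w \in omega then a else 1 - a).

Definition subset_prob E : R := \sum_omega subset_pmf omega * (E omega)%:R.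

Lemma subset_pmf_ge0 omega : 0 <= subset_pmf omega.
Proof. by apply: prodr_ge0 => w _; case: ifP => _ //; rewrite subr_ge0. Qed.

Lemma subset_prob_superset D : subset_prob (fun omega => D \subset omega) = a ^+ #|D|.
Proof.
rewrite /subset_prob.
(* The indicator of [D \subset omega] becomes a factor 0 for each missed element of [D]; the sum
   over [omega] then factorizes. *)
transitivity (\sum_(omega : {set T})
    \prod_w (if w \in omega then a else if w \in D then 0 else 1 - a)).
  apply: eq_bigr => omega _; rewrite /subset_pmf.
  have [/fintype.subsetP Do|] := boolP (D \subset omega).
    rewrite mulr1; apply: eq_bigr => w _; case: ifPn => // wo.
    by case: ifPn => // /Do; rewrite (negbTE wo).
  move=> /subsetPn[w wD wo]; rewrite mulr0 (bigD1 w)//= (negbTE wo) wD mul0r//.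
transitivity (\prod_w (a + (if w \in D then 0 else 1 - a))); first by rewrite bigA_distr.
rewrite (bigID (mem D))/= [X in _ * X]big1 ?mulr1; last first.
  by move=> w /negbTE ->; rewrite addrC subrK.
by under eq_bigr => w -> do rewrite addr0; rewrite prodr_const.
Qed.

Lemma card_bigcup_disjoint (I : finType) (D : I -> {set T}) (S : {set I}) :
  (forall i j, i != j -> [disjoint D i & D j]%B) ->
  #|\bigcup_(i in S) D i|%SET = (\sum_(i in S) #|D i|)%N.
Proof.
move=> disj; rewrite [LHS](_ : _ = #|\bigcup_i (if i \in S then D i else finset.set0)|%SET).
  rewrite -sum1_card partition_disjoint_bigcup => [|i j ij].
    rewrite [RHS]big_mkcond; apply: eq_bigr => i _.
    by rewrite sum1_card; case: ifP => //; rewrite cards0.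
  case: ifP => _; last by rewrite -setI_eq0 finset.set0I.
  case: ifP => _; last by rewrite -setI_eq0 finset.setI0.
  exact: disj.
congr #|pred_of_set _|; rewrite big_mkcond; apply: eq_bigr => i _.
by case: ifP.
Qed.

(** Independence of the events [D i \subset omega]. Expanding over subsets [S], each term asks for
    the union of the [D i] with [i] in [S], whose cardinals add up. *)
Lemma expect_disjoint (I : finType) (D : I -> {set T}) (c e : I -> R) :
  (forall i j, i != j -> [disjoint D i & D j]%B) ->
  \sum_omega subset_pmf omega * \prod_i (e i * (D i \subset omega)%:R + c i) =
  \prod_i (e i * a ^+ #|D i| + c i).
Proof.
move=> disj; rewrite [RHS]bigA_distr.
under [LHS]eq_bigr => omega _.
  rewrite (bigA_distr _ _ (fun i => e i * (D i \subset omega)%:R)) mulr_sumr; over.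
rewrite exchange_big; apply: eq_bigr => S _ /=.
pose DS := (\bigcup_(i in S) D i)%SET.
have prodE (F : I -> R) : \prod_i (if i \in S then e i * F i else c i) =
    \prod_i (if i \in S then e i else c i) * \prod_(i in S) F i.
  rewrite [X in _ * X]big_mkcond -big_split; apply: eq_bigr => i _ /=.
  by case: ifP => // _; rewrite mulr1.
rewrite prodE -expr_sum -card_bigcup_disjoint// -subset_prob_superset mulr_sumr.
apply: eq_bigr => omega _; rewrite prodE mulrCA; congr (_ * (_ * _)).
have [/fintype.subsetP DSo|/subsetPn[w /bigcupP[i iS wi] wo]] := boolP (DS \subset omega).
  rewrite big1// => i iS; suff -> : D i \subset omega by [].
  by apply/fintype.subsetP => w wi; apply: DSo; apply/bigcupP; exists i.
rewrite (bigD1 i)//= (_ : (D i \subset omega) = false) ?mul0r//.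
by apply/negP => /fintype.subsetP/(_ _ wi); rewrite (negbTE wo).
Qed.

Lemma le_subset_prob E E' : (forall omega, E omega -> E' omega) ->
  subset_prob E <= subset_prob E'.
Proof.
move=> EE'; apply: ler_sum => omega _; rewrite ler_wpM2l ?subset_pmf_ge0//.
by rewrite ler_nat; case: (E omega) (EE' omega) => // ->.
Qed.

Lemma le_subset_prob_sum (I : finType) (Q : pred I) E (F : I -> pred {set T}) :
  (forall omega, E omega -> exists2 i, Q i & F i omega) ->
  subset_prob E <= \sum_(i | Q i) subset_prob (F i).
Proof.
move=> EF; rewrite /subset_prob exchange_big; apply: ler_sum => omega _ /=.
rewrite -mulr_sumr; rewrite ler_wpM2l ?subset_pmf_ge0//.
case: (boolP (E omega)) => [/EF[i Qi Fi]|_]; last exact: sumr_ge0.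
by rewrite (bigD1 i)//= Fi lerDl sumr_ge0.
Qed.

End RandomSubset.

Lemma include_probE (A : finType) (X : set (config A)) n (R : realType) (alpha : {i01 R})
    (E : set (word_subsets X n)) :
  include_prob alpha E = (subset_prob alpha%:num (fun omega => `[< E omega >]))%:E.
Proof.
rewrite /include_prob fsbig_mkcond.
have -> : [set: word_subsets X n] = [set` enum (word_subsets X n : finType)].
  by apply/seteqP; split=> // omega _; rewrite /= mem_enum.
rewrite -fsbig_seq ?enum_uniq// big_enum/= /subset_prob -sumEFin.
apply: eq_bigr => omega _; rewrite /patch.
have -> : (omega \in E) = `[< E omega >] by apply/idP/asboolP; rewrite inE.
by case: asboolP => _; rewrite ?mulr1 ?mulr0.
Qed.

Lemma sum_geometric_le (R : realType) (r : R) M : 0 <= r < 1 ->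
  \sum_(k < M) r ^+ k <= (1 - r)^-1.
Proof.
move=> /andP[r0 r1]; have r1' : 0 < 1 - r by rewrite subr_gt0.
rewrite -[leRHS]mul1r ler_pdivlMr// mulrC.
have -> : (1 - r) * \sum_(k < M) r ^+ k = 1 - r ^+ M.
  by rewrite -opprB mulNr -subrX1 opprB.
by rewrite gerBl exprn_ge0.
Qed.

Lemma natrX_le (R : realType) (r : R) p : 0 <= r < 1 -> p%:R * r ^+ p <= (1 - r)^-1.
Proof.
move=> r01; apply: le_trans (sum_geometric_le p r01).
have /andP[r0 r1] := r01.
rewrite mulr_natl -[X in _ *+ X]card_ord -sumr_const; apply: ler_sum => i _.
by rewrite ler_wiXn2l// 1?ltW// ltnW.
Qed.

(** As [a * mu <= r ^ 4] and [n <= p + k], a term is at most [C ^ 2 * r ^ (n + 2 * p + k)]. One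
    factor [r ^ p] absorbs the [p] choices of [j]; the geometric sums over [p] and [k] give the
    other two factors [1 / (1 - r)]. *)
Lemma sum_theta_le (R : realType) (a C mu r : R) (c : nat -> R) M n :
  0 <= a -> (0 < n)%N -> 0 < C -> 1 <= mu ->
  (forall m, 0 <= c m <= C * mu ^+ m) -> 0 <= r < 1 -> a * mu <= r ^+ 4 ->
  \sum_(t : 'I_M * 'I_M * 'I_M |
       [&& (0 < t.1.1)%N, (t.2 < t.1.1)%N & (n <= t.1.1 + t.1.2)%N])
    c t.1.1 * c (t.1.2.+1 - n)%N * a ^+ (t.1.1 + t.1.2) <=
  C ^+ 2 * (1 - r)^-1 ^+ 3 * r ^+ n.
Proof.
move=> a_ge0 n_gt0 C_gt0 mu_ge1 cC /[dup] r01 /andP[r0 r1] ar.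
have mu0 : 0 <= mu by rewrite (le_trans _ mu_ge1).
have C0 := ltW C_gt0.
pose G (p k : nat) := C ^+ 2 * (r ^+ n * (r ^+ p * r ^+ p * r ^+ k)).
have G0 p k : 0 <= G p k by rewrite /G !mulr_ge0// ?exprn_ge0.
apply: (@le_trans _ _ (\sum_(t : 'I_M * 'I_M * 'I_M)
    if (t.2 < t.1.1)%N then G t.1.1 t.1.2 else 0)).
  rewrite big_mkcond; apply: ler_sum => -[[p k] j] _ /=.
  have [jp|] := boolP (j < p)%N; last by rewrite andbF.
  case: ifP => // /andP[p0 npk].
  apply: (@le_trans _ _ (C * mu ^+ p * (C * mu ^+ k) * a ^+ (p + k))).
    have /andP[c0 c1] := cC p; have /andP[c0' c1'] := cC (k.+1 - n)%N.
    rewrite ler_wpM2r ?exprn_ge0// ler_pM// (le_trans c1')//.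
    (* As [n > 0], the ear has at most [k] free letters. *)
    by rewrite ler_pM2l// ler_weXn2l//; move: n_gt0; clear; lia.
  have -> : C * mu ^+ p * (C * mu ^+ k) * a ^+ (p + k) = C ^+ 2 * (a * mu) ^+ (p + k).
    by rewrite exprMn !exprD; ring.
  rewrite /G ler_wpM2l ?exprn_ge0//.
  apply: (@le_trans _ _ ((r ^+ 4) ^+ (p + k))).
    by apply: lerXn2r => //; rewrite nnegrE ?mulr_ge0 ?exprn_ge0.
  by rewrite -!exprM -!exprD ler_wiXn2l// 1?ltW//; move: npk; clear; lia.
rewrite -(pair_bigA _ (fun (pk : 'I_M * 'I_M) (j : 'I_M) =>
  if (j < pk.1)%N then G pk.1 pk.2 else 0))/=.
rewrite -(pair_bigA _ (fun (p k : 'I_M) => \sum_(j < M) if (j < p)%N then G p k else 0))/=.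
have s0 : 0 < (1 - r)^-1 by rewrite invr_gt0 subr_gt0.
apply: (@le_trans _ _ (\sum_(p < M) \sum_(k < M)
    C ^+ 2 * (1 - r)^-1 * r ^+ n * r ^+ p * r ^+ k)).
  apply: ler_sum => p _; apply: ler_sum => k _; rewrite -big_mkcond/=.
  rewrite (big_ord_narrow (ltnW (ltn_ord p)))/= sumr_const card_ord -mulr_natl.
  have -> : p%:R * G p k = C ^+ 2 * r ^+ n * r ^+ p * r ^+ k * (p%:R * r ^+ p).
    by rewrite /G; ring.
  have -> : C ^+ 2 * (1 - r)^-1 * r ^+ n * r ^+ p * r ^+ k =
    C ^+ 2 * r ^+ n * r ^+ p * r ^+ k * (1 - r)^-1 by ring.
  by rewrite ler_wpM2l ?natrX_le// !mulr_ge0 ?exprn_ge0.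
under eq_bigr => p _ do rewrite -mulr_sumr mulrAC.
rewrite -mulr_sumr.
have -> : C ^+ 2 * (1 - r)^-1 ^+ 3 * r ^+ n =
  C ^+ 2 * (1 - r)^-1 * r ^+ n * (1 - r)^-1 * (1 - r)^-1 by ring.
apply: ler_pM; rewrite ?sum_geometric_le//; last first.
  rewrite ler_wpM2l ?sum_geometric_le//.
  by rewrite !mulr_ge0 ?exprn_ge0// ltW.
- by apply: sumr_ge0 => i _; rewrite exprn_ge0.
- rewrite !mulr_ge0 ?exprn_ge0//; first by rewrite ltW.
  by apply: sumr_ge0 => i _; rewrite exprn_ge0.
Qed.

(** * Probability that some window lies on two loops *)

Section ManyLoops.
Variables (R : realType) (A : finType) (X : set (config A)) (n : nat) (a C mu : R).
Hypotheses (a_ge0 : 0 <= a) (a_le1 : a <= 1) (n_gt0 : (0 < n)%N).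
Hypotheses (C_gt0 : 0 < C) (mu_ge1 : 1 <= mu)
  (X_growth : forall m, #|words X m|%:R <= C * mu ^+ m)
  (X_windows : forall omega : word_subsets X n,
     random_SFT omega = window_shift [set val u | u in omega]%SET).

Let wordT := {w : n.-tuple A | w \in words X n}.
Let valset (omega : {set wordT}) : {set n.-tuple A} := [set val u | u in omega]%SET.

Let sub_random (omega : {set wordT}) : window_shift (valset omega) `<=` X.
Proof. by rewrite -X_windows => x []. Qed.

(** Union bound over the shapes [p, k, j] and the words [u, v] of [ex_theta]. The [p + k] distinct
    windows bound [p] and [k] by the number of all words, and are all included with probability
    [a ^ (p + k)]. *)
Lemma subset_prob_loops_sum (d : A) :
  subset_prob a (fun omega : {set wordT} => `[< ~ unique_loops (valset omega) >]) <=
  \sum_(t : 'I_(#|{: n.-tuple A}|.+1) * 'I_(#|{: n.-tuple A}|.+1) * 'I_(#|{: n.-tuple A}|.+1) |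
       [&& (0 < t.1.1)%N, (t.2 < t.1.1)%N & (n <= t.1.1 + t.1.2)%N])
    #|words X t.1.1|%:R * #|words X (t.1.2.+1 - n)|%:R * a ^+ (t.1.1 + t.1.2).
Proof.
pose D p k j (u v : seq A) : {set wordT} :=
  [set w : wordT | val w \in theta_windows d n p k j u v]%SET.
pose F (t : 'I_(#|{: n.-tuple A}|.+1) * 'I_(#|{: n.-tuple A}|.+1) * 'I_(#|{: n.-tuple A}|.+1))
    (omega : {set wordT}) :=
  [exists uv : t.1.1.-tuple A * (t.1.2.+1 - n).-tuple A,
    [&& uv.1 \in words X t.1.1, uv.2 \in words X (t.1.2.+1 - n),
      D t.1.1 t.1.2 t.2 uv.1 uv.2 \subset omega &
      #|D t.1.1 t.1.2 t.2 uv.1 uv.2| == (t.1.1 + t.1.2)%N]].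
pose Q (t : 'I_(#|{: n.-tuple A}|.+1) * 'I_(#|{: n.-tuple A}|.+1) * 'I_(#|{: n.-tuple A}|.+1)) :=
  [&& (0 < t.1.1)%N, (t.2 < t.1.1)%N & (n <= t.1.1 + t.1.2)%N].
have EF : forall omega : {set wordT}, `[< ~ unique_loops (valset omega) >] ->
    exists2 t, Q t & F t omega.
  move=> omega /asboolP/(ex_theta d n_gt0)[p [k [j [u [v [p0 jp npk [uW vW] [TW cT]]]]]]].
  have pkM : (p + k < #|{: n.-tuple A}|.+1)%N by rewrite ltnS -cT max_card.
  have pM : (p < #|{: n.-tuple A}|.+1)%N by lia.
  have kM : (k < #|{: n.-tuple A}|.+1)%N by lia.
  have jM : (j < #|{: n.-tuple A}|.+1)%N by lia.
  exists (Ordinal pM, Ordinal kM, Ordinal jM); first by rewrite /Q /= p0 jp npk.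
  apply/existsP; exists (u, v) => /=.
  rewrite (fintype.subsetP (words_subset _ (@sub_random omega)))//=.
  rewrite (fintype.subsetP (words_subset _ (@sub_random omega)))//=.
  have TD : theta_windows d n p k j u v = [set val w | w in D p k j u v]%SET.
    apply/setP => w; apply/idP/imsetP => [wT|[w' + ->]]; last by rewrite inE.
    have /imsetP[w' _ ww'] := fintype.subsetP TW _ wT.
    by exists w' => //; rewrite inE -ww'.
  apply/andP; split.
    apply/fintype.subsetP => w; rewrite inE => /(fintype.subsetP TW)/imsetP[w' w'o].
    by move/val_inj ->.
  by rewrite -cT TD card_imset//; exact: val_inj.
have := le_subset_prob_sum a_ge0 a_le1 EF.
move/le_trans; apply.
apply: ler_sum => t _.
pose D' (uv : t.1.1.-tuple A * (t.1.2.+1 - n).-tuple A) := D t.1.1 t.1.2 t.2 uv.1 uv.2.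
apply: (le_trans (le_subset_prob_sum a_ge0 a_le1
  (Q := mem (finset.setX (words X t.1.1) (words X (t.1.2.+1 - n))))
  (F := fun uv omega => (D' uv \subset omega) && (#|D' uv| == (t.1.1 + t.1.2)%N)) _)).
  move=> omega /existsP[[u v] /and4P[u1 u2 Do Dc]]; exists (u, v); last exact/andP.
  by rewrite /= finset.in_setX u1.
rewrite -natrM -cardsX mulr_natl -sumr_const; apply: ler_sum => uv _.
(* A configuration whose windows collide or are not all words of [X] contributes 0, the cardinal
   being part of the event. *)
have [<-|ne] := eqVneq #|D' uv| (t.1.1 + t.1.2)%N.
  by rewrite -subset_prob_superset; apply: le_subset_prob => // omega /andP[].
rewrite /subset_prob big1 ?exprn_ge0// => omega _.
by rewrite andbF mulr0.
Qed.

Lemma subset_prob_loops r : X !=set0 -> 0 <= r < 1 -> a * mu <= r ^+ 4 ->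
  subset_prob a (fun omega : {set wordT} => `[< ~ unique_loops (valset omega) >]) <=
  C ^+ 2 * (1 - r)^-1 ^+ 3 * r ^+ n.
Proof.
move=> [x _] r01 ar; apply: (le_trans (subset_prob_loops_sum (x 0))).
apply: (@sum_theta_le _ _ _ mu r (fun m => #|words X m|%:R)) => // m.
by rewrite X_growth ler0n.
Qed.

End ManyLoops.

(** * Surviving periodic orbits *)

Section Orbits.
Variable A : finType.
Implicit Types (x y : config A) (g : set (config A)) (p q n : nat) (X : set (config A)).

Lemma ex_minimal_period p x : (0 < p)%N -> has_period p x ->
  exists q, [/\ (0 < q)%N, forall r, has_period r x <-> (q %| r)%N &
    forall i j : nat, (i < q)%N -> (j < q)%N -> translate i x = translate j x -> i = j].
Proof.
move=> p0 px; have ex : exists q, (0 < q)%N && `[< has_period q x >].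
  by exists p; rewrite p0; apply/asboolP.
case: (ex_minnP ex) => q /andP[q0 /asboolP qx] qmin.
have periodr r : has_period r x <-> (q %| r)%N.
  split=> [rx|/dvdnP[k ->]]; last by rewrite mulnC; exact: periodic_mul.
  have rq : has_period (r %% q)%N x.
    move=> i; rewrite -(rx i) -(periodicZ (i + (r %% q)%N%:Z) (r %/ q)%N%:Z qx).
    by congr (x _); rewrite {3}(divn_eq r q) PoszD PoszM; lia.
  rewrite /dvdn; apply/negPn/negP; rewrite -lt0n => r0.
  have := qmin (r %% q)%N; rewrite r0 /= leqNgt ltn_pmod// => H.
  by have /H : `[< has_period (r %% q)%N x >] by apply/asboolP.
exists q; split=> // i j iq jq.
wlog ij : i j iq jq / (i <= j)%N.
  by move=> H ij; have [/H->//|/ltnW/H<-//] := leqP i j.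
move=> xij; have /periodr/dvdnP[[|k]] : has_period (j - i)%N x.
  move=> l; have := congr1 (@^~ (l - i%:Z)) xij; rewrite /translate subrK => ->.
  by congr (x _); lia.
- by lia.
- by rewrite mulSn; lia.
Qed.

Lemma orbitE p x : (0 < p)%N -> has_period p x ->
  orbit x = (fun i => translate i%:Z x) @` `I_p.
Proof.
move=> p0 px; apply/seteqP; split=> [y /orbitP[k ->]|_ [i _ <-]]; last first.
  exact: orbit_translate px.
exists (k %% p)%N; first by rewrite /= ltn_pmod.
apply/funext => i; rewrite /translate.
rewrite -(periodicZ (i + (k %% p)%N%:Z) (k %/ p)%N%:Z px).
by congr (x _); rewrite {3}(divn_eq k p) PoszD PoszM; lia.
Qed.

(** Identifies [nb_points g] with the least period of a point of [g]. *)
Lemma periodic_orbit_points X g : periodic_orbits X g -> exists x,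
  [/\ X x, g = orbit x, (0 < nb_points g)%N,
    forall r, has_period r x <-> (nb_points g %| r)%N &
    forall i j : nat, (i < nb_points g)%N -> (j < nb_points g)%N ->
      translate i x = translate j x -> i = j].
Proof.
move=> /periodic_orbitsP[x [p [Xx p0 px ->]]]; exists x.
have [q [q0 qx qinj]] := ex_minimal_period p0 px.
suff -> : nb_points (orbit x) = q by [].
rewrite /nb_points; apply: card_fset_set.
rewrite (orbitE q0); last exact/qx.
apply: inj_card_eq => i j; rewrite !inE /= => iq jq; exact: qinj.
Qed.

Section OrbitWords.
Variables (X : set (config A)) (n : nat).
Let wordT := {w : n.-tuple A | w \in words X n}.

(** Reading at position 0 loses nothing: a periodic orbit contains all translates of its points. *)
Definition orbit_words g : {set wordT} :=
  [set w : wordT | `[< exists2 x, g x & window n x 0 = val w >]]%SET.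

(** Injectivity of windows on [g] is a hypothesis because it comes from two sources: a large [n], or
    unique loops. *)
Lemma card_orbit_words g : periodic_orbits X g ->
  (forall x y, g x -> g y -> window n x 0 = window n y 0 -> x = y) ->
  #|orbit_words g| = nb_points g.
Proof.
move=> Xg ginj; have [x [Xx gx g0 gper gx_inj]] := periodic_orbit_points Xg.
have tx i : g (translate i x).
  by rewrite gx; apply: orbit_translate g0 _; apply/gper.
have gE y : g y -> exists2 i, (i < nb_points g)%N & translate i%:Z x = y.
  move=> gy; have : orbit x y by rewrite -gx.
  by rewrite (orbitE g0); [move=> [i ip <-]; exists i|apply/gper].
rewrite -[RHS]card_ord -(card_imset _ (f := fun i : 'I_(nb_points g) => window n x i)).
  rewrite -(card_imset _ val_inj); congr #|pred_of_set _|; apply/setP => w.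
  apply/imsetP/imsetP => [[v + ->]|[i _ ->]].
    rewrite inE => /asboolP[_ /gE[i ilt <-] <-].
    by exists (Ordinal ilt) => //=; rewrite window_translate add0r.
  have wX : window n x i \in words X n by apply/wordsP; exists x, i.
  exists (exist (fun w => w \in words X n) _ wX) => //; rewrite inE; apply/asboolP; exists (translate i x); first exact: tx.
  by rewrite window_translate add0r.
move=> i j wij; apply/val_inj; apply: gx_inj; [exact: ltn_ord|exact: ltn_ord|].
by apply: ginj; [exact: tx|exact: tx|rewrite !window_translate !add0r].
Qed.

Lemma orbit_words_sub g (omega : word_subsets X n) : is_SFT X -> periodic_orbits X g ->
  random_SFT omega = window_shift [set val u | u in omega]%SET ->
  g `<=` random_SFT omega <-> orbit_words g \subset omega.
Proof.
move=> XSFT Xg ->.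
have gX y : g y -> X y.
  by move: Xg => /periodic_orbitsP[z [p [Xz p0 pz ->]]] /orbitP[k ->]; exact: SFT_translate.
split=> [go|/fintype.subsetP go y gy i].
  apply/fintype.subsetP => w; rewrite inE => /asboolP[y /go/(_ 0) /imsetP[v vo ->]].
  by move/val_inj <-.
have ty : g (translate i y).
  have [z [p [_ p0 pz gz]]] := (periodic_orbitsP _ _).1 Xg.
  move: gy; rewrite gz => /orbitP[k ->].
  by rewrite translateD; exact: orbit_translate pz.
have wX : window n y i \in words X n by apply/wordsP; exists y, i; split=> //; exact: gX.
apply/imsetP; exists (exist (fun w => w \in words X n) _ wX) => //.
apply: go; rewrite inE; apply/asboolP; exists (translate i y) => //.
by rewrite window_translate add0r.
Qed.

(** The product of the two sizes is a common period, at most [B * B], so [n] letters determine both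
    points. *)
Lemma periodic_orbits_window g g' (B : nat) x y : (B * B <= n)%N ->
  periodic_orbits X g -> periodic_orbits X g' ->
  (nb_points g <= B)%N -> (nb_points g' <= B)%N -> g x -> g' y ->
  window n x 0 = window n y 0 -> x = y.
Proof.
move=> Bn Xg Xg' gB gB'.
have [z [Xz gz z0 zp _]] := periodic_orbit_points Xg.
have [z' [Xz' gz' z0' zp' _]] := periodic_orbit_points Xg'.
rewrite {1}gz {1}gz' => /orbitP[k ->] /orbitP[k' ->] /windowP ww.
apply: (@eq_periodic _ (nb_points g * nb_points g')%N _ _ 0).
- by rewrite muln_gt0 z0.
- by apply/periodic_translate/zp; exact: dvdn_mulr.
- by apply/periodic_translate/zp'; exact: dvdn_mull.
- by move=> l lp; apply: ww; rewrite (leq_trans lp)// (leq_trans _ Bn)// leq_mul.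
Qed.

Lemma periodic_orbit_eq g g' x : periodic_orbits X g -> periodic_orbits X g' ->
  g x -> g' x -> g = g'.
Proof.
suff sub h h' z : periodic_orbits X h -> periodic_orbits X h' -> h z -> h' z -> h `<=` h'.
  by move=> Xg Xg' gx gx'; apply/seteqP; split; exact: (sub _ _ x).
move=> /periodic_orbitsP[y [p [_ p0 py ->]]] /periodic_orbitsP[y' [p' [_ p0' py' ->]]].
move=> /orbitP[k ->] /orbitP[k' yy] _ /orbitP[l ->].
have -> : translate l y = translate (l%:Z - k%:Z) (translate k y).
  by rewrite translateD subrK.
by rewrite yy translateD; exact: (orbit_translate _ p0' py').
Qed.

Lemma disjoint_orbit_words g g' (B : nat) : (B * B <= n)%N ->
  periodic_orbits X g -> periodic_orbits X g' ->
  (nb_points g <= B)%N -> (nb_points g' <= B)%N -> g <> g' ->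
  [disjoint orbit_words g & orbit_words g']%B.
Proof.
move=> Bn Xg Xg' gB gB' gg'; rewrite -setI_eq0; apply/eqP/setP => w.
rewrite !inE; apply/negP => /andP[/asboolP[x gx xw] /asboolP[y gy yw]]; apply: gg'.
have xy : x = y.
  by apply: (periodic_orbits_window Bn Xg Xg' gB gB' gx gy); rewrite xw yw.
by apply: (periodic_orbit_eq Xg Xg' gx); rewrite xy.
Qed.

End OrbitWords.
End Orbits.

Lemma subset_prob_dist (R : realType) (T : finType) (a : R) (E F B B' : pred {set T}) :
  0 <= a <= 1 -> (forall omega, E omega != F omega -> B omega || B' omega) ->
  `|subset_prob a E - subset_prob a F| <= subset_prob a B + subset_prob a B'.
Proof.
move=> /andP[a0 a1] EF; rewrite /subset_prob -sumrB -big_split/=.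
apply: (le_trans (ler_norm_sum _ _ _)); apply: ler_sum => omega _.
rewrite -mulrBr -mulrDr normrM ger0_norm ?subset_pmf_ge0// ler_wpM2l ?subset_pmf_ge0//.
have := EF omega; case: (E omega); case: (F omega); case: (B omega); case: (B' omega) => //= H;
  rewrite ?subrr ?subr0 ?sub0r ?normrN ?normr0 ?normr1 ?addr0 ?add0r ?ler0n ?ler01 ?lexx//;
  by [have := H isT|rewrite -natrD ler1n].
Qed.

(** * Counting components by the surviving orbits of small index *)

Section VisibleOrbits.
Variables (R : realType) (A : finType) (X : set (config A)).
Variables (J : set nat) (gamma : nat -> set (config A)) (a : R).
Hypotheses (X_SFT : is_SFT X) (gamma_enum : set_bij J (periodic_orbits X) gamma).
Hypothesis (a01 : 0 <= a <= 1).

(** The value 0 outside [J] lets finite and infinite enumerations be handled by sums and products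
    over all naturals. *)
Definition orbit_weight (s : nat) : R := if s \in J then a ^+ nb_points (gamma s) else 0.

Lemma orbit_weight_ge0 s : 0 <= orbit_weight s.
Proof. by rewrite /orbit_weight; case: ifP => // _; rewrite exprn_ge0//; case/andP: a01. Qed.

Lemma gamma_periodic s : s \in J -> periodic_orbits X (gamma s).
Proof. by rewrite inE => Js; case: gamma_enum => H _ _; apply: H. Qed.

Lemma gamma_inj s t : s \in J -> t \in J -> gamma s = gamma t -> s = t.
Proof. by case: gamma_enum => _ H _; apply: H. Qed.

Section Window.
Variable n : nat.
Let wordT := {w : n.-tuple A | w \in words X n}.
Let valset (omega : {set wordT}) : {set n.-tuple A} := [set val u | u in omega]%SET.

Definition visible N (omega : {set wordT}) : {set 'I_N} :=
  [set s : 'I_N | (val s \in J) && (orbit_words X n (gamma s) \subset omega)]%SET.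

Lemma subset_prob_visible N (B : nat) (S : {set 'I_N}) : (B * B <= n)%N ->
  (forall s : 'I_N, val s \in J -> (nb_points (gamma s) <= B)%N) ->
  subset_prob a (fun omega => visible N omega == S) =
  \prod_(s < N) (if s \in S then orbit_weight s else 1 - orbit_weight s).
Proof.
move=> Bn gB.
(* The indicator of [visible N omega = S] is a product of affine functions of the indicators of
   [D s \subset omega]: for [s] in [J], the indicator itself if [s] is in [S], its complement
   otherwise. *)
pose D (s : 'I_N) : {set wordT} := if val s \in J then orbit_words X n (gamma s) else finset.set0.
pose e (s : 'I_N) : R := (if s \in S then 1 else -1) * (val s \in J)%:R.
pose c (s : 'I_N) : R := (s \notin S)%:R.
transitivity (\sum_omega subset_pmf a omega * \prod_s (e s * (D s \subset omega)%:R + c s)).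
  apply: eq_bigr => omega _; congr (_ * _).
  have factor s : e s * (D s \subset omega)%:R + c s = ((s \in visible N omega) == (s \in S))%:R.
    rewrite /e /c /D inE; case: (s \in S); case: (val s \in J); rewrite /= ?mulr1 ?mul1r ?mulr0 ?mul0r ?addr0 ?add0r//.
      by case: (_ \subset _).
    by case: (_ \subset _); rewrite ?mulr1 ?mulr0 ?addNr ?add0r.
  under [RHS]eq_bigr => s _ do rewrite factor.
  have [->|vS] := eqVneq (visible N omega) S; first by rewrite big1// => s _; rewrite eqxx.
  have [s sN] : exists s, (s \in visible N omega) != (s \in S).
    apply/existsP; apply: contra_neqT vS; rewrite negb_exists => /forallP H.
    by apply/setP => s; apply/eqP; have := H s; rewrite negbK.
  by rewrite (bigD1 s)//= (negbTE sN) mul0r.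
rewrite expect_disjoint; last first.
  move=> s t st; rewrite /D.
  case: ifP => sJ; last by rewrite -setI_eq0 finset.set0I.
  case: ifP => tJ; last by rewrite -setI_eq0 finset.setI0.
  apply: (disjoint_orbit_words Bn); rewrite ?gB//; try exact: gamma_periodic.
  by move=> /(gamma_inj sJ tJ)/val_inj/eqP; rewrite (negbTE st).
apply: eq_bigr => s _; rewrite /e /c /D /orbit_weight.
have cD : val s \in J -> #|orbit_words X n (gamma s)| = nb_points (gamma s).
  move=> sJ; apply: card_orbit_words; first exact: gamma_periodic.
  by move=> x y; apply: (periodic_orbits_window Bn); rewrite ?gB//; exact: gamma_periodic.
case: ifPn => sS; case: ifPn => sJ; rewrite /= ?(cD sJ) ?mulr1 ?mulr0 ?mul0r ?addr0 ?add0r ?subr0//.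
  by rewrite mul1r.
by rewrite mulN1r addrC.
Qed.

Lemma subset_prob_card_visible N (B : nat) (h : nat -> bool) : (B * B <= n)%N ->
  (forall s : 'I_N, val s \in J -> (nb_points (gamma s) <= B)%N) ->
  subset_prob a (fun omega => h #|visible N omega|) =
  \sum_(S : {set 'I_N} | h #|S|)
    \prod_(s < N) (if s \in S then orbit_weight s else 1 - orbit_weight s).
Proof.
move=> Bn gB; under [RHS]eq_bigr => S _ do rewrite -(subset_prob_visible S Bn gB).
rewrite exchange_big; apply: eq_bigr => omega _ /=.
rewrite -mulr_sumr; congr (_ * _).
rewrite big_mkcond (bigD1 (visible N omega))//= eqxx big1 ?addr0; first by case: h.
by move=> S vS; rewrite eq_sym (negbTE vS); case: ifP.
Qed.

Hypothesis X_windows : forall omega : word_subsets X n,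
  random_SFT omega = window_shift (valset omega).

(** Under unique loops the components are the surviving periodic orbits of [X], here all of index
    below [N]. *)
Lemma nb_components_visible N (omega : word_subsets X n) :
  unique_loops (valset omega) ->
  (forall s, (N <= s)%N -> s \in J -> ~~ (orbit_words X n (gamma s) \subset omega)) ->
  nb_irreducible_components (random_SFT omega) = #|visible N omega|.
Proof.
move=> uloops Nlarge.
rewrite /nb_irreducible_components X_windows irreducible_componentsE// -X_windows.
have YX : random_SFT omega `<=` X by move=> x [].
have gE g : periodic_orbits (random_SFT omega) g <->
    exists2 s : nat, s \in J /\ orbit_words X n (gamma s) \subset omega & gamma s = g.
  split=> [/periodic_orbitsP[x [p [Yx p0 px gx]]]|[s [sJ so] <-]].
    have Xg : periodic_orbits X g by apply/periodic_orbitsP; exists x, p; split=> //; exact: YX.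
    case: gamma_enum => _ _ /(_ _ Xg)[s Js gs].
    exists s => //; split; first exact/mem_set.
    apply/(orbit_words_sub X_SFT _ (X_windows omega)); first by rewrite gs.
    rewrite gs gx X_windows => y /orbitP[k ->].
    by apply: window_shift_translate; rewrite -X_windows.
  have Xs := gamma_periodic sJ.
  have /periodic_orbitsP[x [p [Xx p0 px gx]]] := Xs.
  apply/periodic_orbitsP; exists x, p; split=> //.
  move: so => /(orbit_words_sub X_SFT Xs (X_windows omega)); apply.
  by rewrite gx; exact: orbit_self.
have -> : periodic_orbits (random_SFT omega) =
    [set` [fset gamma (val s) | s in visible N omega]%fset].
  apply/seteqP; split=> [g /gE[s [sJ so] <-]|g /= /imfsetP[s /= + ->]].
    have sN : (s < N)%N by rewrite ltnNge; apply/negP => /Nlarge/(_ sJ); rewrite so.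
    by apply/imfsetP; exists (Ordinal sN); rewrite //= inE /= sJ.
  by rewrite inE => /andP[sJ so]; apply/gE; exists s.
rewrite set_fsetK card_in_imfset /=; first by rewrite -cardE.
move=> s t; rewrite !inE => /andP[sJ _] /andP[tJ _] st.
exact/val_inj/(gamma_inj sJ tJ).
Qed.

(** An orbit of large index may be long compared with [n]. Under unique loops, however, a surviving
    orbit has exactly [nb_points] words, so its survival costs [orbit_weight] in the union bound. *)
Lemma subset_prob_far N (eps : R) :
  (forall M, \sum_(N <= s < M) orbit_weight s <= eps) ->
  subset_prob a (fun omega => `[< unique_loops (valset omega) /\
     exists s, [/\ (N <= s)%N, s \in J & orbit_words X n (gamma s) \subset omega] >]) <= eps.
Proof.
have /andP[a0 a1] := a01.
move=> tail; set E := (fun omega : {set wordT} => _).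
(* Choosing one far orbit per [omega] leaves finitely many indices, those below [M]. *)
have /choice[f fP] (omega : {set wordT}) : exists s, E omega ->
    [/\ (N <= s)%N, s \in J & orbit_words X n (gamma s) \subset omega].
  by have [/asboolP[_ [s sP]]|nE] := boolP (E omega); [exists s|exists 0%N].
pose M := (\max_(omega : {set wordT}) f omega).+1.
pose Q (i : 'I_M) := [&& (N <= i)%N, val i \in J &
  #|orbit_words X n (gamma i)| == nb_points (gamma i)].
apply: (@le_trans _ _ (\sum_(i | Q i)
    subset_prob a (fun omega => orbit_words X n (gamma i) \subset omega))).
  apply: le_subset_prob_sum => // omega Eo; have [Nf fJ fo] := fP _ Eo.
  have fM : (f omega < M)%N by rewrite ltnS leq_bigmax.
  exists (Ordinal fM) => //; rewrite /Q /= Nf fJ; apply/eqP.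
  have Xg := gamma_periodic fJ.
  apply: card_orbit_words => // x y gx gy xy.
  have gY : gamma (f omega) `<=` window_shift (valset omega).
    by rewrite -X_windows; apply/(orbit_words_sub X_SFT Xg (X_windows omega)).
  move/asboolP : Eo => [uloops _].
  have [z [_ gz z0 zp _]] := periodic_orbit_points Xg.
  have per u : gamma (f omega) u -> has_period (nb_points (gamma (f omega))) u.
    by rewrite {1}gz => /orbitP[k ->]; apply/periodic_translate/zp.
  by apply: (unique_loops_at (i := 0) uloops _ _ z0 z0 _ _ xy); auto.
apply: (@le_trans _ _ (\sum_(i < M | (N <= i)%N) orbit_weight i)).
  rewrite big_mkcond [leRHS]big_mkcond; apply: ler_sum => i _.
  rewrite /Q; case: ifP => [/and3P[-> iJ /eqP ci]|_].
    by rewrite subset_prob_superset// ci /orbit_weight iJ.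
  by case: ifP => // _; exact: orbit_weight_ge0.
by have := tail M; rewrite big_geq_mkord.
Qed.

Lemma subset_prob_nb_components N (B : nat) (h : nat -> bool) (eps : R) : (B * B <= n)%N ->
  (forall s : 'I_N, val s \in J -> (nb_points (gamma s) <= B)%N) ->
  (forall M, \sum_(N <= s < M) orbit_weight s <= eps) ->
  `|subset_prob a (fun omega : {set wordT} =>
       h (nb_irreducible_components (random_SFT (omega : word_subsets X n)))) -
    \sum_(S : {set 'I_N} | h #|S|)
       \prod_(s < N) (if s \in S then orbit_weight s else 1 - orbit_weight s)| <=
  subset_prob a (fun omega : {set wordT} => `[< ~ unique_loops (valset omega) >]) + eps.
Proof.
move=> Bn gB tail; rewrite -(subset_prob_card_visible h Bn gB).
apply: (le_trans _ (lerD (lexx _) (subset_prob_far tail))).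
apply: subset_prob_dist => // omega hh; apply/negPn/negP; rewrite negb_or.
move=> /andP[/asboolPn/contrapT uloops /asboolPn nfar].
move/eqP : hh; apply; congr h; apply: nb_components_visible => // s Ns sJ.
by apply/negP => so; apply: nfar; split=> //; exists s.
Qed.

End Window.
End VisibleOrbits.

(** * The zeta function *)

(** Passes between real and extended real series, so that nonnegative double sums can be
    interchanged. *)
Lemma nneseries_real (R : realType) (u : nat -> R) l : (forall k, 0 <= u k) ->
  (\sum_(k <oo) (u k)%:E)%E = l%:E <-> \sum_(0 <= k < n) u k @[n --> \oo] --> l.
Proof.
move=> u0.
have uE : (fun n => (\sum_(0 <= k < n) (u k)%:E)%E) = (fun n => (\sum_(0 <= k < n) u k)%:E).
  by apply/funext => n; rewrite sumEFin.
split=> [ul|ul].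
  have : ((fun n => (\sum_(0 <= k < n) (u k)%:E)%E) @ \oo --> l%:E)%classic.
    by rewrite -ul; apply: is_cvg_nneseries => k _ _; rewrite lee_fin.
  by rewrite uE => /fine_cvg.
rewrite uE; apply: cvg_lim => //; apply: cvg_EFin => //; exact: nearW.
Qed.

(** Mean value theorem on [[1 - x, 1]] for [p n] at [1 - y] plus [ln y]: its derivative
    [(1 - y) ^ n / y] is what a geometric sum leaves of [1 / y]. The error is at most
    [x ^ (n + 1) / (1 - x)]. *)
Lemma log_series (R : realType) (x : R) : 0 <= x < 1 ->
  (\sum_(k <oo) (x ^+ k / k%:R)%:E)%E = (- ln (1 - x))%:E.
Proof.
move=> /andP[x0 x1]; have x1' : 0 < 1 - x by rewrite subr_gt0.
apply/nneseries_real => [k|]; first by rewrite divr_ge0 ?exprn_ge0.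
rewrite -cvg_shiftS /=.
(* The term [k = 0] vanishes because the inverse of 0 is 0. *)
pose p n : {poly R} := \poly_(k < n.+1) k%:R^-1.
have pE n t : (p n).[t] = \sum_(0 <= k < n.+1) t ^+ k / k%:R.
  by rewrite horner_poly big_mkord; apply: eq_bigr => k _; rewrite mulrC.
have dpE n t : (p n)^`().[t] * (1 - t) = 1 - t ^+ n.
  have -> : (p n)^`() = \poly_(k < n) 1.
    apply/polyP => i; rewrite coef_deriv !coef_poly ltnS.
    case: ifP => _; last by rewrite mul0rn.
    by rewrite -[LHS]mulr_natl divff ?pnatr_eq0.
  rewrite horner_poly; under eq_bigr do rewrite mul1r.
  by rewrite mulrC -opprB mulNr -subrX1 opprB.
pose h n y := (p n \Po (1 - 'X)).[y] + ln y.
have hE n : exists2 c, 1 - x <= c <= 1 & - ln (1 - x) - (p n).[x] = (1 - c) ^+ n / c * x.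
  have dh (c : R) : 0 < c -> is_derive c 1 (h n) ((1 - c) ^+ n / c).
    move=> c0; have c0' := gt_eqF c0.
    have D := is_deriveD (is_derive_poly (p n \Po (1 - 'X)) c) (is_derive1_ln c0).
    apply: (is_derive_eq (f := h n) D); rewrite deriv_comp derivB derivX derivC sub0r.
    rewrite hornerM horner_comp !hornerE.
    have := dpE n (1 - c); rewrite subKr => dpc.
    apply: (mulIf (negbT c0')); rewrite mulrDl mulVf ?c0'// divfK ?c0'//.
    by rewrite mulrN1 mulNr dpc; ring.
  have [|||c] := @MVT_segment _ (h n) (fun c => (1 - c) ^+ n / c) (1 - x) 1.
  - by rewrite gerBl.
  - move=> c; rewrite in_itv /= => /andP[c1 _]; apply: dh; exact: lt_trans c1.
  - apply: derivable_within_continuous => c; rewrite in_itv /= => /andP[c1 _].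
    by have [] := dh c (lt_le_trans x1' c1).
  rewrite in_itv /= => cx hc; exists c => //.
  move: hc; rewrite /h !horner_comp !hornerE subrr subKr ln1 => hc.
  rewrite -hc addr0.
  have -> : (p n).[0] = 0.
    by rewrite pE big_nat_recl// invr0 mulr0 big1 ?addr0// => i _; rewrite exprS mul0r mul0r.
  by ring.
have bound n : 0 <= - ln (1 - x) - (p n).[x] <= x ^+ n.+1 / (1 - x).
  have [c /andP[xc c1] ->] := hE n.
  have c0 : 0 < c by exact: lt_le_trans xc.
  apply/andP; split; first by rewrite !mulr_ge0 ?exprn_ge0 ?subr_ge0 ?invr_ge0// ltW.
  rewrite exprSr [leRHS]mulrAC ler_wpM2r//.
  apply: ler_pM; rewrite ?exprn_ge0 ?subr_ge0 ?invr_ge0 ?(ltW c0)//.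
    by apply: lerXn2r; rewrite ?nnegrE ?subr_ge0//; lra.
  by rewrite lef_pV2 ?posrE.
apply/cvgrPdist_le => e e0; near=> n.
rewrite -pE; have /andP[b0 b1] := bound n.
rewrite ger0_norm//; apply: (le_trans b1).
rewrite ler_pdivrMr// exprSr (@le_trans _ _ (x ^+ n))//.
  by rewrite ler_piMr ?exprn_ge0// ltW.
near: n.
have xn : x ^+ n @[n --> \oo] --> 0 by apply: cvg_expr; rewrite ger0_norm.
have /cvgrPdist_le/(_ (e * (1 - x)) (mulr_gt0 e0 x1')) := xn.
apply: filterS => n; rewrite sub0r normrN ger0_norm ?exprn_ge0//.
Unshelve. all: by end_near.
Qed.

(** * Fixed points counted orbit by orbit *)

Section FixedPoints.
Local Open Scope card_scope.
Variables (A : finType) (X : set (config A)).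

Definition fixed_points p : set (config A) := [set x | X x /\ iter p (@Defs.shift A) x = x].

Lemma window_fixed_inj p : (0 < p)%N ->
  {in fixed_points p &, injective (fun x : config A => window p x 0)}.
Proof.
move=> p0 x y; rewrite !inE => -[_ /has_periodP px] [_ /has_periodP py] /windowP xy.
exact: (@eq_periodic _ p _ _ 0).
Qed.

Lemma fixed_points_card_le p : (0 < p)%N -> fixed_points p #<= `I_(#|words X p|).
Proof.
move=> p0; have cF := card_esym (inj_card_eq (window_fixed_inj p0)).
have -> : #|words X p| = #|` [fset w | w in words X p]%fset| by rewrite card_imfset// -cardE.
have /card_eq_fsetP cI : #|` [fset w | w in words X p]%fset| = #|` [fset w | w in words X p]%fset|.
  by [].
rewrite (card_le_eql cF) -(card_le_eqr cI); apply: subset_card_le.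
move=> _ [x [Xx _] <-]; apply/imfsetP; exists (window p x 0) => //.
by apply/wordsP; exists x, 0.
Qed.

Lemma finite_fixed_points p : (0 < p)%N -> finite_set (fixed_points p).
Proof. by move=> p0; apply: card_le_finite (fixed_points_card_le p0) (finite_II _). Qed.

Lemma nb_fixed_points_le p : (0 < p)%N -> (nb_fixed_points X p <= #|words X p|)%N.
Proof. by move=> p0; exact: geq_card_fset_set (fixed_points_card_le p0). Qed.

Lemma esum_nb_points (R : realType) (S : set (config A)) : finite_set S ->
  (\esum_(x in S) (1 : R)%:E)%E = (nb_points S)%:R%:E.
Proof.
move=> finS; rewrite esum_fset// fsbig_finite// sumEFin big_const_seq count_predT.
by rewrite iter_addr_0.
Qed.

Variables (R : realType) (J : set nat) (gamma : nat -> set (config A)).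
Hypotheses (X_SFT : is_SFT X) (gamma_enum : set_bij J (periodic_orbits X) gamma).

(** The points fixed by the [p]-th iterate are the disjoint union of the orbits whose size divides
    [p]. *)
Lemma nb_fixed_points_sum p : (0 < p)%N ->
  (nb_fixed_points X p)%:R%:E =
  (\sum_(s <oo) (if (s \in J) && (nb_points (gamma s) %| p)%N
                 then (nb_points (gamma s))%:R else 0 : R)%:E)%E.
Proof.
move=> p0; rewrite -[LHS](esum_nb_points R (finite_fixed_points p0)).
pose K s := if (s \in J) && (nb_points (gamma s) %| p)%N then gamma s else set0.
have gF s : (s \in J) && (nb_points (gamma s) %| p)%N -> gamma s `<=` fixed_points p.
  move=> /andP[sJ dp] y gy; have Xs := gamma_periodic gamma_enum sJ.
  have [x [Xx gx _ per _]] := periodic_orbit_points Xs.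
  move: gy; rewrite gx => /orbitP[k ->]; split; first exact: SFT_translate.
  by apply/has_periodP/periodic_translate/per.
have -> : fixed_points p = \bigcup_s K s.
  apply/seteqP; split=> [x [Xx xp]|x [s _]]; last first.
    by rewrite /K; case: ifP => // /gF; apply.
  have Xg : periodic_orbits X (orbit x).
    by apply/periodic_orbitsP; exists x, p; split=> //; exact/has_periodP.
  have [_ _ /(_ _ Xg)[s Js gs]] := gamma_enum.
  have sJ : s \in J by exact/mem_set.
  have [y [Xy gy _ per _]] := periodic_orbit_points (gamma_periodic gamma_enum sJ).
  have gxs : gamma s x by rewrite gs; exact: orbit_self.
  have dp : (nb_points (gamma s) %| p)%N.
    apply/per; have [z [q [_ q0 qz zx]]] := (periodic_orbitsP _ _).1 Xg.
    have : orbit x y by rewrite -gs gy; exact: orbit_self.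
    by move=> /orbitP[k ->]; exact/periodic_translate/has_periodP.
  by exists s => //; rewrite /K sJ dp.
rewrite nneseries_sum_bigcup//; last first.
  move=> s t _ _ [x []]; rewrite /K; case: ifP => // /andP[sJ _] gs.
  case: ifP => // /andP[tJ _] gt; apply: (gamma_inj gamma_enum sJ tJ).
  exact: (periodic_orbit_eq (gamma_periodic gamma_enum sJ) (gamma_periodic gamma_enum tJ) gs gt).
apply: eq_eseriesr => s _; rewrite /K; case: ifP => [sJp|_]; last by rewrite esum_set0.
by rewrite esum_nb_points//; apply: sub_finite_set (gF _ sJp) (finite_fixed_points p0).
Qed.

(** With [p = d * k] the term becomes [(a ^ d) ^ k / k]. *)
Lemma log_series_multiples (a : R) (d : nat) : 0 <= a < 1 -> (0 < d)%N ->
  (\sum_(p <oo) (if (0 < p)%N && (d %| p)%N then d%:R / p%:R * a ^+ p else 0 : R)%:E)%E =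
  (- ln (1 - a ^+ d))%:E.
Proof.
move=> /andP[a0 a1] d0; rewrite -log_series; last first.
  by rewrite exprn_ge0//= exprn_ilt1// -lt0n.
rewrite !nneseries_esumT; first last.
- by move=> p; case: ifP => _; rewrite lee_fin// mulr_ge0 ?divr_ge0 ?exprn_ge0.
- by move=> k; rewrite lee_fin divr_ge0 ?exprn_ge0.
pose Q := [set p : nat | (0 < p)%N && (d %| p)%N].
transitivity (\esum_(p in Q) (d%:R / p%:R * a ^+ p)%:E).
  rewrite [RHS]esum_mkcond; apply: eq_esum => p _.
  have -> : (p \in Q) = (0 < p)%N && (d %| p)%N by apply/idP/idP => [/set_mem//|]; exact: mem_set.
  by case: ifP.
rewrite (reindex_esum [set k : nat | (0 < k)%N] Q (fun k => d * k)%N); last first.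
  split.
  - by move=> k /= k0; rewrite /Q /= muln_gt0 d0 k0 dvdn_mulr.
  - by move=> k l _ _ /eqP; rewrite eqn_pmul2l// => /eqP.
  - move=> p /= /andP[p0 /dvdnP[k pk]]; exists k; last by rewrite pk mulnC.
    by move: p0; rewrite pk muln_gt0 => /andP[].
rewrite esum_mkcond; apply: eq_esum => k _.
have -> : (k \in [set k : nat | (0 < k)%N]) = (0 < k)%N.
  by apply/idP/idP => [/set_mem//|]; exact: mem_set.
have dR : d%:R != 0 :> R by rewrite pnatr_eq0 -lt0n.
case: ifPn => [k0|]; last by rewrite -leqNgt leqn0 => /eqP ->; rewrite invr0 mulr0.
congr EFin; rewrite natrM invfM mulrA divff// mul1r exprM mulrC.
by rewrite mulrC.
Qed.

End FixedPoints.

(** * The product formula for the zeta function *)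

Section ZetaProduct.
Variables (R : realType) (A : finType) (X : set (config A)).
Variables (J : set nat) (gamma : nat -> set (config A)) (a C mu : R).
Hypotheses (X_SFT : is_SFT X) (gamma_enum : set_bij J (periodic_orbits X) gamma).
Hypotheses (a_ge0 : 0 <= a) (mu_ge1 : 1 <= mu) (amu_lt1 : a * mu < 1)
  (X_growth : forall m, #|words X m|%:R <= C * mu ^+ m).

Let w := orbit_weight J gamma a.

Let a_lt1 : a < 1.
Proof. by apply: le_lt_trans amu_lt1; rewrite ler_peMr. Qed.

Let a01 : 0 <= a <= 1.
Proof. by rewrite a_ge0 ltW. Qed.

Lemma orbit_weight_le s : w s <= a.
Proof.
rewrite /w /orbit_weight; case: ifPn => // sJ.
have [x [_ _ d0 _ _]] := periodic_orbit_points (gamma_periodic gamma_enum sJ).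
by rewrite -[leRHS]expr1 ler_wiXn2l// ltW.
Qed.

Let w_ge0 s : 0 <= w s. Proof. exact: orbit_weight_ge0. Qed.
Let w_lt1 s : w s < 1. Proof. exact: le_lt_trans (orbit_weight_le s) a_lt1. Qed.

Let u p : R := (nb_fixed_points X p)%:R / p%:R * a ^+ p.

Let u_ge0 p : 0 <= u p.
Proof. by rewrite /u mulr_ge0 ?divr_ge0 ?exprn_ge0. Qed.

(** [u 0] is 0 because the inverse of 0 is 0. *)
Let uE n : \sum_(0 <= p < n) u p = \sum_(1 <= p < n) u p.
Proof.
case: n => [|n]; first by rewrite !big_geq.
by rewrite big_ltn// {1}/u invr0 mulr0 mul0r add0r.
Qed.

Let cvg_u : cvgn (fun n => \sum_(0 <= p < n) u p).
Proof.
apply: nondecreasing_is_cvgn.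
  by apply/nondecreasing_seqP => n; rewrite big_nat_recr//= lerDl.
have b01 : 0 <= a * mu < 1 by rewrite amu_lt1 andbT mulr_ge0// (le_trans _ mu_ge1).
have C0 : 0 <= C by have := X_growth 0; rewrite expr0 mulr1; exact: le_trans.
exists (C * (1 - a * mu)^-1) => _ [n _ <-].
apply: (@le_trans _ _ (\sum_(p < n) C * (a * mu) ^+ p)); last first.
  by rewrite -mulr_sumr ler_wpM2l// sum_geometric_le.
rewrite big_mkord; apply: ler_sum => -[p pn] _ /=; rewrite /u.
case: p pn => [|p] _; first by rewrite invr0 mulr0 mul0r expr0 mulr1.
have -> : C * (a * mu) ^+ p.+1 = C * mu ^+ p.+1 * a ^+ p.+1 by rewrite exprMn; ring.
rewrite ler_wpM2r ?exprn_ge0// ler_pdivrMr ?ltr0n//.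
apply: (@le_trans _ _ (#|words X p.+1|%:R)); first by rewrite ler_nat nb_fixed_points_le.
by rewrite (le_trans (X_growth _))// ler_peMr ?ler1n// (le_trans _ (X_growth p.+1)).
Qed.

(** A nonnegative double series [F p s] is summed in two ways: over orbits it gives [u p], by
    counting fixed points; over [p] it gives [- ln (1 - w s)]. *)
Lemma cvg_sum_ln_weight : exists2 L, zeta X a = expR L &
  \sum_(0 <= s < N) - ln (1 - w s) @[N --> \oo] --> L.
Proof.
exists (limn (fun n => \sum_(1 <= p < n) u p)) => //.
set L := limn _.
have uL : \sum_(0 <= p < n) u p @[n --> \oo] --> L.
  have := cvg_u; rewrite (_ : (fun n => _) = (fun n => \sum_(1 <= p < n) u p))//.
  by apply/funext => n; exact: uE.
apply/nneseries_real => [s|].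
  by rewrite oppr_ge0 ln_le0// gerBl.
move/(nneseries_real _ u_ge0) : uL => <-.
pose F p s : R := if [&& (0 < p)%N, s \in J & (nb_points (gamma s) %| p)%N]
  then (nb_points (gamma s))%:R / p%:R * a ^+ p else 0.
have F0 p s : 0 <= F p s.
  by rewrite /F; case: ifP => // _; rewrite mulr_ge0 ?divr_ge0 ?exprn_ge0.
transitivity (\sum_(s <oo) \sum_(p <oo) (F p s)%:E)%E; last first.
  rewrite nneseries_interchange; last by move=> *; rewrite lee_fin.
  apply: eq_eseriesr => p _; have [->|p0] := posnP p.
    by rewrite /u invr0 mulr0 mul0r eseries0// => s _ _; rewrite /F.
  rewrite /u mulrAC -mulrA mulrC EFinM (nb_fixed_points_sum R X_SFT gamma_enum p0).
  rewrite -nneseriesZl; last by move=> s _; case: ifP; rewrite lee_fin.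
  apply: eq_eseriesr => s _; rewrite -EFinM /F p0 /=; congr EFin.
  by case: ifP => _; rewrite ?mulr0// mulrAC [RHS]mulrC mulrA.
apply: eq_eseriesr => s _; have [sJ|sJ] := boolP (s \in J); last first.
  rewrite eseries0; last by move=> p _ _; rewrite /F (negbTE sJ) andbF.
  by rewrite /w /orbit_weight (negbTE sJ) subr0 ln1 oppr0.
have [x [_ _ d0 _ _]] := periodic_orbit_points (gamma_periodic gamma_enum sJ).
rewrite /w /orbit_weight sJ -log_series_multiples ?a_ge0//.
by apply: eq_eseriesr => p _; rewrite /F sJ.
Qed.

Lemma prod_weightE N : \prod_(s < N) (1 - w s) = expR (- \sum_(0 <= s < N) - ln (1 - w s)).
Proof.
rewrite -sumrN big_mkord expR_sum; apply: eq_bigr => s _.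
by rewrite opprK lnK// posrE subr_gt0.
Qed.

Lemma cvg_prod_weight : \prod_(s < N) (1 - w s) @[N --> \oo] --> (zeta X a)^-1.
Proof.
have [L -> wL] := cvg_sum_ln_weight; rewrite -expRN.
under eq_fun do rewrite prod_weightE.
apply: (@cvg_comp _ _ _ _ (expR : R -> R)); first exact: cvgN wL.
exact: continuous_expR.
Qed.

Lemma zeta_gt0 : 0 < zeta X a.
Proof. by have [L -> _] := cvg_sum_ln_weight; exact: expR_gt0. Qed.

(** The tails of the series of [- ln (1 - w s)] dominate those of [w], since
    [w s <= - ln (1 - w s)]. *)
Lemma ex_tail_weight : exists2 eps : nat -> R, eps N @[N --> \oo] --> 0 &
  forall N M, \sum_(N <= s < M) w s <= eps N.
Proof.
have [L _ wL] := cvg_sum_ln_weight.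
pose S N := \sum_(0 <= s < N) - ln (1 - w s).
exists (fun N => L - S N).
  by rewrite -(subrr L); apply: cvgB => //; exact: cvg_cst.
move=> N M.
have Sndec : nondecreasing_seq S.
  by apply/nondecreasing_seqP => n; rewrite /S big_nat_recr//= lerDl oppr_ge0 ln_le0// gerBl.
have SL n : S n <= L.
  by rewrite -(cvg_lim _ wL)//; apply: nondecreasing_cvgn_le => //; apply/cvg_ex; exists L.
have [MN|NM] := leqP M N; first by rewrite big_geq// subr_ge0.
rewrite lerBrDl; apply: le_trans (SL M).
rewrite /S [leRHS](@big_cat_nat _ _ _ N) ?(ltnW NM)//= lerD2l; apply: ler_sum => s _.
rewrite lerNr; have := @le_ln1Dx _ (- w s); rewrite ltrN2; apply; exact: w_lt1.
Qed.

End ZetaProduct.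

(** * The limit law *)

Definition finite_subsets : Type := {fset nat}.

HB.instance Definition _ := Choice.on finite_subsets.
HB.instance Definition _ := isPointed.Build finite_subsets (fset0 : {fset nat}).
HB.instance Definition _ := @isMeasurable.Build default_measure_display
  finite_subsets discrete_measurable discrete_measurable0
  discrete_measurableC discrete_measurableU.

Section ProductWeights.
Variables (R : realType) (b : nat -> R).
Hypothesis b_ge0 : forall s, 0 <= b s.

Definition subset_weight (S : {fset nat}) : R := \prod_(s <- S) b s.

Lemma subset_weight_ge0 S : 0 <= subset_weight S.
Proof. exact: prodr_ge0. Qed.

(* The proof argument only lets the measure structure below be inferred. *)
Definition weight_measure (_ : forall s, 0 <= b s) (E : set finite_subsets) : \bar R :=
  (\esum_(S in E) (subset_weight S)%:E)%E.

Let weight_measure0 : weight_measure b_ge0 set0 = 0%E.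
Proof. exact: esum_set0. Qed.

Let weight_measure_ge0 E : (0 <= weight_measure b_ge0 E)%E.
Proof. by apply: esum_ge0 => S _; rewrite lee_fin subset_weight_ge0. Qed.

Let weight_measure_sigma_additive : semi_sigma_additive (weight_measure b_ge0).
Proof.
move=> F mF tF mUF; rewrite /weight_measure nneseries_sum_bigcup//; last first.
  by move=> S; rewrite lee_fin subset_weight_ge0.
apply: is_cvg_nneseries => k _ _.
by apply: esum_ge0 => S _; rewrite lee_fin subset_weight_ge0.
Qed.

HB.instance Definition _ := isMeasure.Build _ _ _ (weight_measure b_ge0)
  weight_measure0 weight_measure_ge0 weight_measure_sigma_additive.

Definition bounded_subsets (h : nat -> bool) N : set finite_subsets :=
  [set S : {fset nat} | (forall s, s \in S -> (s < N)%N) /\ h #|` S|].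

Lemma weight_measure_bounded h N : weight_measure b_ge0 (bounded_subsets h N) =
  (\sum_(S : {set 'I_N} | h #|S|) \prod_(s in S) b s)%:E.
Proof.
pose e (S : {set 'I_N}) : finite_subsets := [fset val s | s in S]%fset.
have card_e S : #|` e S : {fset nat}| = #|S|.
  by rewrite /e card_imfset /=; [rewrite -cardE|exact: val_inj].
rewrite /weight_measure (reindex_esum [set S : {set 'I_N} | h #|S|] _ e); last first.
  split.
  - move=> S /= hS; split; last by rewrite card_e.
    by move=> s /imfsetP[i _ ->]; exact: ltn_ord.
  - move=> S S' _ _ /fsetP SS'; apply/setP => i; have := SS' (val i).
    have mem U : (val i \in (e U : {fset nat})) = (i \in U).
      by apply/imfsetP/idP => [[j jU /val_inj ->//]|iU]; exists i.
    by rewrite !mem.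
  - move=> S [SN hS]; have eS : e [set i : 'I_N | val i \in (S : {fset nat})]%SET = S.
      apply/fsetP => s; apply/imfsetP/idP => [[i]|sS]; first by rewrite /= inE => iS ->.
      by exists (Ordinal (SN _ sS)); rewrite //= inE.
    by exists [set i : 'I_N | val i \in (S : {fset nat})]%SET; rewrite //= -card_e eS.
rewrite esum_fset; [|exact: finite_finset|by move=> *; rewrite lee_fin subset_weight_ge0].
have -> : [set S : {set 'I_N} | h #|S|] = [set` seq.filter (fun S : {set 'I_N} => h #|S|) (enum {: {set 'I_N}})].
  by apply/seteqP; split=> S /=; rewrite mem_filter mem_enum andbT.
rewrite -fsbig_seq ?filter_uniq -?enumT ?enum_uniq// big_filter big_enum_cond/= sumEFin.
congr EFin; apply: eq_bigr => S _; rewrite /subset_weight /e big_imfset /=.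
  by rewrite big_enum.
by move=> i j _ _; exact: val_inj.
Qed.

(** Continuity from below: every finite set of naturals lies below some [N]. *)
Lemma cvg_weight_measure h :
  ((\sum_(S : {set 'I_N} | h #|S|) \prod_(s in S) b s)%:E @[N --> \oo] -->
   weight_measure b_ge0 [set S : finite_subsets | h #|` (S : {fset nat})|])%E.
Proof.
rewrite (_ : [set S | _] = \bigcup_N bounded_subsets h N); last first.
  apply/seteqP; split=> [S hS|S [N _ []//]].
  exists (\max_(s <- S) s).+1 => //; split=> // s sS.
  by rewrite ltnS; exact: leq_bigmax_seq.
rewrite (_ : (fun N => _) = weight_measure b_ge0 \o bounded_subsets h); last first.
  by apply/funext => N; rewrite /= weight_measure_bounded.
apply: nondecreasing_cvg_mu => //.
move=> N M NM; apply/subsetPset => S [SN hS]; split=> // s sS.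
exact: leq_trans (SN _ sS) NM.
Qed.

Lemma weight_measureT_le B : (forall N, \prod_(s < N) (1 + b s) <= B) ->
  (weight_measure b_ge0 setT <= B%:E)%E.
Proof.
move=> bB; have := @cvg_weight_measure xpredT.
rewrite (_ : [set S | _] = setT); last by apply/seteqP; split.
move=> cv; rewrite -(cvg_lim _ cv)//; apply: lime_le; first by apply/cvg_ex; eexists; exact: cv.
apply: nearW => N; rewrite lee_fin (le_trans _ (bB N))//.
under [leRHS]eq_bigr do rewrite addrC.
rewrite bigA_distr; apply: ler_sum => S _.
by rewrite big_mkcond.
Qed.

End ProductWeights.

Section LimitLaw.
Variables (R : realType) (w : nat -> R) (a z e0 : R).
Hypotheses (w_ge0 : forall s, 0 <= w s) (w_le : forall s, w s <= a) (a_lt1 : a < 1).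
Hypotheses (z_gt0 : 0 < z) (w_prod : \prod_(s < N) (1 - w s) @[N --> \oo] --> z^-1)
  (w_sum : forall N, \sum_(0 <= s < N) w s <= e0).

(** With [orbit_weight] for [w], the factor of orbit [s] in the limit law, and 0 for indices outside
    [J]. *)
Definition odds s : R := w s / (1 - w s).

Let w1 s : 0 < 1 - w s.
Proof. by rewrite subr_gt0; apply: le_lt_trans a_lt1. Qed.

Lemma odds_ge0 s : 0 <= odds s.
Proof. by rewrite divr_ge0// ltW. Qed.

Lemma odds_sum N : \sum_(s < N) odds s <= e0 / (1 - a).
Proof.
have a1 : 0 < 1 - a by rewrite subr_gt0.
apply: (@le_trans _ _ ((\sum_(0 <= s < N) w s) / (1 - a))); last first.
  by rewrite ler_wpM2r ?invr_ge0// ltW.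
rewrite big_mkord mulr_suml; apply: ler_sum => s _; apply: ler_wpM2l => //.
by rewrite lef_pV2 ?posrE// lerD2l lerN2.
Qed.

Lemma prod_odds N : \prod_(s < N) (1 + odds s) = (\prod_(s < N) (1 - w s))^-1.
Proof.
rewrite -prodfV; apply: eq_bigr => s _.
by rewrite -[1 in LHS](divff (lt0r_neq0 (w1 s))) -mulrDl subrK mul1r.
Qed.

(** The Dirac mass is the fallback of [mnormalize] for a total mass 0 or infinite; here the total
    mass is [z]. *)
Definition limit_law : set finite_subsets -> \bar R :=
  mnormalize (weight_measure odds_ge0) (\d_(fset0 : finite_subsets)).

HB.instance Definition _ := Probability.on limit_law.

Lemma weight_measure_odds_setT : weight_measure odds_ge0 setT = z%:E.
Proof.
have := @cvg_weight_measure _ _ odds_ge0 xpredT.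
rewrite (_ : [set S | _] = setT); last by apply/seteqP; split.
move=> cv; rewrite -(cvg_lim _ cv)//; apply: cvg_lim => //.
apply: cvg_EFin; first exact: nearW.
rewrite (_ : _ \o _ = fun N => (\prod_(s < N) (1 - w s))^-1).
  rewrite -[X in _ --> X]invrK; apply: cvgV => //.
  by rewrite invr_neq0// gt_eqF.
apply/funext => N; rewrite /= -prod_odds; under [RHS]eq_bigr do rewrite addrC.
by rewrite bigA_distr; apply: eq_bigr => S _; rewrite big_mkcond.
Qed.

Lemma limit_lawE E : limit_law E = (weight_measure odds_ge0 E * (z^-1)%:E)%E.
Proof.
by rewrite /limit_law /mnormalize /= weight_measure_odds_setT eqe gt_eqF.
Qed.

(** Factoring out all the [1 - w s] turns the independent law on the first [N] indices into products
    of odds times a constant that tends to [1 / z]. *)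
Lemma cvg_limit_law (h : nat -> bool) :
  (\sum_(S : {set 'I_N} | h #|S|)
      \prod_(s < N) (if s \in S then w s else 1 - w s))%:E @[N --> \oo] -->
  limit_law [set S : finite_subsets | h #|` (S : {fset nat})|].
Proof.
rewrite limit_lawE.
rewrite (_ : (fun N => _) = (fun N : nat =>
  (\sum_(S : {set 'I_N} | h #|S|) \prod_(s in S) odds s)%:E * (\prod_(s < N) (1 - w s))%:E)%E).
  apply: cvgeM => //.
  - apply: mule_def_fin => //; rewrite ge0_fin_numE//.
    rewrite (le_lt_trans _ (ltry z))// -weight_measure_odds_setT.
    by apply: le_measure => //; rewrite inE.
  - exact: cvg_weight_measure.
  - by apply: cvg_EFin => //; exact: nearW.
apply/funext => N; rewrite -EFinM mulr_suml; congr EFin; apply: eq_bigr => S _.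
rewrite [X in X * _]big_mkcond -big_split /=; apply: eq_bigr => s _.
by case: ifP; rewrite ?mul1r// /odds divfK// lt0r_neq0.
Qed.

Definition nb_elements (S : finite_subsets) : R := #|` (S : {fset nat})|%:R.

HB.instance Definition _ := isMeasurableFun.Build _ _ finite_subsets R nb_elements
  (fun _ _ _ => I).

(** Exponential Markov bound: multiplying every odds by [e] raises the weight of a set with at least
    [k] elements by at least [e ^ k], and the total mass is then at most [expR] of [e] times the sum
    of the odds. *)
Lemma limit_law_tail k :
  (limit_law [set S : finite_subsets | (k <= #|` (S : {fset nat})|)%N] <=
   (z^-1 * expR (expR 1 * (e0 / (1 - a))) * expR (- k%:R))%:E)%E.
Proof.
have eb_ge0 s : 0 <= expR 1 * odds s by rewrite mulr_ge0 ?expR_ge0 ?odds_ge0.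
rewrite limit_lawE muleC -mulrA EFinM lee_pmul2l ?lte_fin ?invr_gt0//.
have wT : (weight_measure eb_ge0 setT <= (expR (expR 1 * (e0 / (1 - a))))%:E)%E.
  apply: weight_measureT_le => N.
  apply: (@le_trans _ _ (\prod_(s < N) expR (expR 1 * odds s))).
    by apply: ler_prod => s _; rewrite addr_ge0//= expR_ge1Dx.
  by rewrite -expR_sum ler_expR -mulr_sumr ler_wpM2l ?expR_ge0// odds_sum.
apply: ge_ereal_sup => _ [F [finF FE] <-].
rewrite fsbig_finite// sumEFin lee_fin expRN ler_pdivlMr ?expR_gt0// mulr_suml.
rewrite -lee_fin; apply: le_trans wT; rewrite -sumEFin.
apply: (@le_trans _ _ (\sum_(S \in F) (subset_weight (fun s => expR 1 * odds s) S)%:E)%E);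
  last by apply: ereal_sup_ubound; exists F.
rewrite [leRHS]fsbig_finite//= big_seq [leRHS]big_seq; apply: lee_sum => S.
rewrite in_fset_set// inE => /FE /= kS; rewrite lee_fin /subset_weight [leRHS]big_split /= mulrC.
rewrite ler_wpM2r ?(subset_weight_ge0 odds_ge0 S)//.
rewrite big_const_seq count_predT iter_mulr_1 -expRM_natl mulr1 ler_expR ler_nat//.
Qed.

Lemma nb_elements_moment m : ('E_(limit_law)[fun S => (`|nb_elements S| ^+ m)%R] < +oo)%E.
Proof.
rewrite unlock.
pose F k := [set S : finite_subsets | #|` (S : {fset nat})| = k].
have FT : [set: finite_subsets] = \bigcup_k F k.
  by apply/seteqP; split=> // S _; exists #|` (S : {fset nat})|.
rewrite FT ge0_integral_bigcup//; last first.
  by move=> k l _ _ [S [<- <-]].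
set K := z^-1 * expR (expR 1 * (e0 / (1 - a))).
(* [expR (- k)] is a product of [m + 1] factors [r ^ k]: [m] of them absorb [k ^ m] through
   [k * r ^ k <= 1 / (1 - r)], and the last one makes the series converge. *)
pose r : R := expR (- (m.+1%:R)^-1).
have r01 : 0 <= r < 1 by rewrite expR_ge0/= expR_lt1 oppr_lt0 invr_gt0.
have /andP[r0 r1] := r01.
have r1' : 0 <= (1 - r)^-1 by rewrite invr_ge0 subr_ge0 ltW.
have K0 : 0 <= K by rewrite mulr_ge0 ?expR_ge0 ?invr_ge0 ?ltW.
have tailK k : (limit_law [set S : finite_subsets | (k <= #|` (S : {fset nat})|)%N] <=
    (K * expR (- k%:R))%:E)%E by exact: limit_law_tail.
clearbody K.
apply: (@le_lt_trans _ _ (\sum_(k <oo) (K * (1 - r)^-1 ^+ m * r ^+ k)%:E)%E); last first.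
  apply: (@le_lt_trans _ _ ((K * (1 - r)^-1 ^+ m * (1 - r)^-1)%:E)); last exact: ltry.
  apply: lime_le.
    by apply: is_cvg_nneseries => k _ _; rewrite lee_fin !mulr_ge0 ?exprn_ge0.
  apply: nearW => N; rewrite sumEFin lee_fin -mulr_sumr big_mkord ler_wpM2l ?sum_geometric_le//.
  by rewrite mulr_ge0 ?exprn_ge0.
apply: lee_nneseries => k _.
  by move=> _; apply: integral_ge0 => S _; rewrite lee_fin exprn_ge0.
have -> : (\int[limit_law]_(S in F k) (`|nb_elements S| ^+ m)%:E = (k%:R ^+ m)%:E * limit_law (F k))%E.
  rewrite -integral_cst//; apply: eq_integral => S; rewrite inE => Sk.
  by rewrite /nb_elements Sk ger0_norm.
apply: (@le_trans _ _ ((k%:R ^+ m)%:E * (K * expR (- k%:R))%:E)%E).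
  rewrite lee_wpmul2l ?lee_fin ?exprn_ge0//; apply: le_trans (tailK k).
  by apply: le_measure; rewrite ?inE// => S /= ->.
rewrite -EFinM lee_fin.
have -> : expR (- k%:R) = (r ^+ k) ^+ m * r ^+ k :> R.
  rewrite -exprM -exprD addnC -mulnS /r -expRM_natl; congr expR.
  by rewrite natrM mulrN mulfK.
have -> : k%:R ^+ m * (K * ((r ^+ k) ^+ m * r ^+ k)) = K * (k%:R * r ^+ k) ^+ m * r ^+ k.
  by rewrite exprMn; ring.
rewrite ler_wpM2r ?exprn_ge0 ?expR_ge0// ler_wpM2l//.
by apply: lerXn2r; rewrite ?nnegrE ?natrX_le ?mulr_ge0 ?exprn_ge0.
Qed.

End LimitLaw.

(** * Convergence *)

Section Convergence.
Variables (R : realType) (A : finType) (X : set (config A)) (a C mu : R).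
Hypotheses (X_SFT : is_SFT X) (X_neq0 : X !=set0).
Hypotheses (a01 : 0 <= a <= 1) (C_gt0 : 0 < C) (mu_ge1 : 1 <= mu) (amu_lt1 : a * mu < 1)
  (X_growth : forall m, #|words X m|%:R <= C * mu ^+ m).

Definition loops_prob n : R := subset_prob a
  (fun omega : {set {w : n.-tuple A | w \in words X n}} =>
     `[< ~ unique_loops [set val u | u in omega]%SET >]).

Lemma cvg_loops_prob : loops_prob n @[n --> \oo] --> 0.
Proof.
have /andP[a0 a1] := a01.
have b0 : 0 <= a * mu by rewrite mulr_ge0// (le_trans _ mu_ge1).
pose r := Num.sqrt (Num.sqrt (a * mu)).
have r4 : r ^+ 4 = a * mu by rewrite /r (exprM _ 2 2) !sqr_sqrtr// sqrtr_ge0.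
have r01 : 0 <= r < 1.
  rewrite sqrtr_ge0/= ltNge; apply/negP => r1.
  by have := exprn_ege1 4 r1; rewrite r4 leNgt amu_lt1.
have [n0 n0P] := random_SFT_windows X_SFT.
apply: (@squeeze_cvgr _ _ _ _ (cst 0) (fun n => C ^+ 2 * (1 - r)^-1 ^+ 3 * r ^+ n)).
- near=> n; apply/andP; split.
    by apply: sumr_ge0 => omega _; rewrite mulr_ge0 ?subset_pmf_ge0.
  rewrite /loops_prob. 
  apply: (subset_prob_loops a0 a1 _ C_gt0 mu_ge1 X_growth) => //; last by rewrite r4.
    by near: n; exact: nbhs_infty_gt.
  by apply: n0P; near: n; exact: nbhs_infty_ge.
- exact: cvg_cst.
- rewrite -[X in _ --> X](mulr0 (C ^+ 2 * (1 - r)^-1 ^+ 3)); apply: cvgMr.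
  by apply: cvg_expr; case/andP: r01 => r0 r1; rewrite ger0_norm.
Unshelve. all: by end_near.
Qed.

Lemma cvg_zero_entropy : subset_prob a
    (fun omega : {set {w : n.-tuple A | w \in words X n}} =>
       `[< zero_entropy R (random_SFT (omega : word_subsets X n)) >])
  @[n --> \oo] --> (1 : R).
Proof.
have [n0 n0P] := random_SFT_windows X_SFT.
apply/cvgrPdist_le => e e0.
have /cvgrPdist_le/(_ (e / 2) (divr_gt0 e0 (ltr0Sn _ 1))) := cvg_loops_prob.
move=> loops; near=> n.
have n0n : (n0 <= n)%N by near: n; exact: nbhs_infty_ge.
have ngt0 : (0 < n)%N by near: n; exact: nbhs_infty_gt.
have Ln : loops_prob n <= e / 2.
  apply: (le_trans (ler_norm _)); rewrite -normrN -sub0r.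
  by near: n.
(* The limit 1 is written as the probability of a sure event, so that [subset_prob_dist] compares
   the two; both bad events are the failure of unique loops. *)
have <- : subset_prob a (fun omega : {set {w : n.-tuple A | w \in words X n}} =>
    finset.set0 \subset omega) = 1 by rewrite subset_prob_superset cards0 expr0.
have -> : e = e / 2 + e / 2 by lra.
apply: le_trans (lerD Ln Ln); apply: subset_prob_dist => // omega.
rewrite finset.sub0set orbb => H; apply/asboolP => uloops; move/eqP: H; apply; apply/esym.
apply/asboolP; have [Y0|/set0P Y0] := eqVneq (random_SFT (omega : word_subsets X n)) set0.
  by left.
right; rewrite n0P//; apply: entropy0_poly; first by rewrite -n0P.
by move=> m; exact: leq_card_words_unique_loops.
Unshelve. all: by end_near.
Qed.

Variables (J : set nat) (gamma : nat -> set (config A)).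
Hypothesis gamma_enum : set_bij J (periodic_orbits X) gamma.

(** [N] is fixed first, making the tail of the weights and the distance to [l] small; then [n] is
    taken so large that the first [N] orbits have disjoint windows. *)
Lemma cvg_nb_components (h : nat -> bool) (l : R) :
  \sum_(S : {set 'I_N} | h #|S|) \prod_(s < N)
    (if s \in S then orbit_weight J gamma a s else 1 - orbit_weight J gamma a s)
    @[N --> \oo] --> l ->
  subset_prob a (fun omega : {set {w : n.-tuple A | w \in words X n}} =>
      h (nb_irreducible_components (random_SFT (omega : word_subsets X n))))
    @[n --> \oo] --> l.
Proof.
move=> cvl; have /andP[a0 a1] := a01.
have [n0 n0P] := random_SFT_windows X_SFT.
have [eps eps0 epsP] := ex_tail_weight X_SFT gamma_enum a0 mu_ge1 amu_lt1 X_growth.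
apply/cvgrPdist_le => e e0; have e3 : 0 < e / 3 by rewrite divr_gt0.
have /cvgrPdist_le/(_ _ e3) loops := cvg_loops_prob.
have /cvgrPdist_le/(_ _ e3) [N1 _ epsN] := eps0.
have /cvgrPdist_le/(_ _ e3) [N2 _ lN] := cvl.
pose N := maxn N1 N2.
have := lN N (leq_maxr _ _); set SN := (X in `|l - X|) => lSN.
have epsN3 : eps N <= e / 3.
  by have := epsN N (leq_maxl _ _); rewrite /= sub0r normrN; apply: le_trans; exact: ler_norm.
pose B := (\max_(s < N) nb_points (gamma s))%N.
near=> n.
have n0n : (n0 <= n)%N by near: n; exact: nbhs_infty_ge.
have Bn : (B * B <= n)%N by near: n; exact: nbhs_infty_ge.
have Ln : loops_prob n <= e / 3.
  apply: (le_trans (ler_norm _)); rewrite -normrN -sub0r.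
  by near: n.
have gB (s : 'I_N) : val s \in J -> (nb_points (gamma s) <= B)%N.
  by move=> _; exact: (leq_bigmax s).
have := subset_prob_nb_components X_SFT gamma_enum a01 (fun omega => n0P _ n0n omega)
  h Bn gB (epsP N).
rewrite -/SN; set Q := subset_prob _ _ => QSN.
have -> : l - Q = (l - SN) + (SN - Q) by ring.
apply: (le_trans (ler_normD _ _)); rewrite [X in _ + X]distrC.
apply: (le_trans (lerD lSN QSN)); rewrite -/(loops_prob n).
by move: Ln epsN3; lra.
Unshelve. all: by end_near.
Qed.

End Convergence.

Theorem theorem1p2 (R : realType) (A : finType) (X : set (config A))
  (X_SFT : is_SFT X) (X_neq0 : X !=set0)
  (lambda : R) (lambda_gt0 : 0 < lambda) (entropyX : entropy R X = ln lambda)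
  (J : set nat) (gamma : nat -> set (config A))
  (gamma_enum : set_bij J (periodic_orbits X) gamma)
  (alpha : {i01 R}) (alpha_lt : alpha%:num < lambda^-1) :
  (include_prob alpha
     [set omega : word_subsets X n | zero_entropy R (random_SFT omega)]
     @[n --> \oo] --> 1%E) /\
  exists (d : measure_display) (T : measurableType d) (P : probability T R)
    (Iinfty : {RV P >-> R}),
    [/\ P [set t | Iinfty t = 0] = ((zeta X alpha%:num)^-1)%:E,
        (forall k : nat, (1 <= k)%N ->
          P [set t | Iinfty t = k%:R%R] =
          ((zeta X alpha%:num)^-1)%:E *
          \esum_(S in [set S : {fset nat} | [set` S] `<=` J /\ #|` S| = k])
            (\prod_(s <- S) (alpha%:num ^+ nb_points (gamma s) /
                             (1 - alpha%:num ^+ nb_points (gamma s)))%R)%:E)%E,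
        cvg_in_distribution
          (fun n => nb_components R : {RV (include_prob (X := X) (n := n) alpha) >-> R})
          Iinfty,
        exponential_tail Iinfty
      & finite_moments Iinfty].
Proof.
have a0 : 0 <= alpha%:num by [].
have a01 : 0 <= alpha%:num <= 1 by rewrite a0 le1.
have [C [mu [C0 mu1 amu growth]]] :=
  words_growth X_neq0 lambda_gt0 entropyX a01 alpha_lt.
have a1 : alpha%:num < 1 by apply: le_lt_trans amu; rewrite ler_peMr.
split.
  under eq_fun do rewrite include_probE.
  apply: cvg_EFin; first exact: nearW.
  exact: (cvg_zero_entropy X_SFT X_neq0 a01 C0 mu1 amu growth).
set w := orbit_weight J gamma alpha%:num.
have w0 s : 0 <= w s by exact: orbit_weight_ge0.
have wle s : w s <= alpha%:num by exact: (orbit_weight_le gamma_enum a0 mu1 amu).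
have z0 : 0 < zeta X alpha%:num by exact: (zeta_gt0 X_SFT gamma_enum a0 mu1 amu growth).
have wprod := cvg_prod_weight X_SFT gamma_enum a0 mu1 amu growth.
have [eps _ epsP] := ex_tail_weight X_SFT gamma_enum a0 mu1 amu growth.
have wsum := epsP 0%N.
pose P := limit_law w0 wle a1.
exists default_measure_display, finite_subsets, P, (@nb_elements R).
split.
- apply: etrans; first exact: (limit_lawE w0 wle a1 z0 wprod).
  (* Only the empty set counts, and its weight is the empty product 1. *)
  rewrite (_ : [set t | _] = [set fset0 : finite_subsets]); last first.
    apply/seteqP; split=> [S /eqP|S ->] /=; rewrite /nb_elements ?cardfs0//.
    by rewrite pnatr_eq0 cardfs_eq0 => /eqP.
  rewrite /weight_measure esum_set1 ?lee_fin ?subset_weight_ge0//; last exact: (odds_ge0 w0 wle a1).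
  by rewrite /subset_weight big_seq_fset0 mul1e.
- move=> k _; apply: etrans; first exact: (limit_lawE w0 wle a1 z0 wprod).
  rewrite muleC; congr (_ * _)%E.
  rewrite /weight_measure esum_mkcond [RHS]esum_mkcond; apply: eq_esum => S _.
  rewrite (_ : (S \in _) = (#|` (S : {fset nat})| == k)); last first.
    by apply/idP/eqP => [/set_mem/eqP|Sk]; [rewrite eqr_nat => /eqP|apply/mem_set; rewrite /= /nb_elements Sk].
  have [Sk|Sk] := eqVneq; last by rewrite memNset//= => -[_ /eqP]; rewrite (negbTE Sk).
  have [SJ|nSJ] := pselect ([set` (S : {fset nat})] `<=` J).
    rewrite mem_set//; congr EFin; rewrite /subset_weight; apply: eq_big_seq => s sS.
    by rewrite /odds /w /orbit_weight mem_set//; exact: SJ.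
  rewrite memNset/=; last by move=> [].
  (* An index outside [J] has odds 0, so only subsets of [J] carry weight. *)
  have [s [sS sJ]] : exists s, s \in (S : {fset nat}) /\ ~ J s.
    apply: contrapT => nex; apply: nSJ => s sS; apply: contrapT => nJ.
    by apply: nex; exists s.
  rewrite /subset_weight (big_fsetD1 s)//= /odds /w /orbit_weight memNset//.
  by rewrite mul0r mul0r.
- move=> x _.
  (* The distribution function at [x] is the probability of the test [h k = (k <= x)] on the number
     of components. *)
  rewrite (_ : (fun n => _) = (fun n => (subset_prob alpha%:num
      (fun omega : {set {w : n.-tuple A | w \in words X n}} =>
         (nb_irreducible_components (random_SFT (omega : word_subsets X n)))%:R <= x))%:E)); last first.
    apply/funext => n; apply: etrans; first exact: (include_probE alpha (_ @^-1` _)).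
    congr (subset_prob _ _)%:E; apply/funext => omega.
    by apply/asboolP/idP; rewrite /= in_itv.
  rewrite (_ : cdf _ x = limit_law w0 wle a1
      [set S : finite_subsets | #|` (S : {fset nat})|%:R <= x]); last first.
    by rewrite /cdf /distribution /pushforward; congr (limit_law _ _ _ _);
      apply/seteqP; split=> S; rewrite /= in_itv.
  have := @cvg_limit_law _ _ _ _ w0 wle a1 z0 wprod (fun k => k%:R <= x).
  set L := limit_law _ _ _ _ => AL.
  have Lfin : L \is a fin_num by exact: fin_num_measure.
  rewrite -(fineK Lfin) in AL *.
  apply: cvg_EFin; first exact: nearW.
  apply: (cvg_nb_components X_SFT X_neq0 a01 C0 mu1 amu growth gamma_enum (h := fun k => k%:R <= x)).
  exact: (fine_cvg AL).
(* The rate is 1, and [eps 0] bounds the sum of all orbit weights. *)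
- exists ((zeta X alpha%:num)^-1 * expR (expR 1 * (eps 0%N / (1 - alpha%:num)))), 1.
  split=> [||k].
  + by rewrite mulr_gt0 ?invr_gt0 ?expR_gt0.
  + exact: ltr01.
  + rewrite mulN1r; apply: le_trans (limit_law_tail w0 wle a1 z0 wprod wsum k).
    apply: le_measure; rewrite ?inE// => S /=.
    by rewrite /nb_elements ler_nat.
- by move=> m; exact: (nb_elements_moment w0 wle a1 z0 wprod wsum m).
Qed.
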